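(* Let $\boldsymbol h=(h_1,\dots,h_n)\in\mathbb C^n$ be a point such that $\sum_{s=1}^n h_s=0$, $\sum_{s=1}^n z_sh_s=l\big(\sum_{s=1}^n m_s+1-l\big)$, and all solutions of the differential equation $\mathcal D_{\boldsymbol h}u(x)=0$ are polynomials. Then there exists an eigenvector (a nonzero vector) $v\in\mathrm{Sing}\,L_{\boldsymbol\Lambda}[\Lambda^{(\infty)}]$ of the action of the Bethe algebra $A_L$ such that for every $s=1,\dots,n$ we have $$\psi_{ML}(H_s)\,v=h_s\,v .$$
   Context: $\mathfrak{gl}_2$ is the Lie algebra of complex $2\times2$ matrices with standard generators $e_{ab}$; $\epsilon_1,\epsilon_2$ is the standard basis of the dual of the diagonal Cartan subalgebra, $\alpha=\epsilon_1-\epsilon_2$. Fix distinct $z_1,\dots,z_n\in\mathbb C$, integers $m_1,\dots,m_n\ge0$ and an integer $l\ge 0$. Put $\Lambda^{(s)}=m_s\epsilon_1$, $\Lambda^{(\infty)}=\sum_{s}\Lambda^{(s)}-l\alpha$, and assume $\Lambda^{(\infty)}$ is dominant integral, i.e. $\sum_s m_s-2l\ge0$. The differential operator is $$\mathcal D_{\boldsymbol h}=\Big(\prod_{s=1}^n(x-z_s)\Big)\Big(\frac{d^2}{dx^2}-\sum_{s=1}^n\frac{m_s}{x-z_s}\frac d{dx}+\sum_{s=1}^n\frac{h_s}{x-z_s}\Big).$$ $M_{\boldsymbol\Lambda}=M_{\Lambda^{(1)}}\otimes\cdots\otimes M_{\Lambda^{(n)}}$ is the tensor product of Verma $\mathfrak{gl}_2$-modules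 with highest weights $\Lambda^{(s)}$, and $L_{\boldsymbol\Lambda}=L_{\Lambda^{(1)}}\otimes\cdots\otimes L_{\Lambda^{(n)}}$ the tensor product of the irreducible $\mathfrak{gl}_2$-modules with the same highest weights. For $N=M_{\boldsymbol\Lambda}$ or $L_{\boldsymbol\Lambda}$, $\mathrm{Sing}\,N[\Lambda^{(\infty)}]=\{v\in N: e_{12}v=0,\ e_{22}v=lv\}$. Let $\sigma:\mathrm{Sing}\,M_{\boldsymbol\Lambda}[\Lambda^{(\infty)}]\to\mathrm{Sing}\,L_{\boldsymbol\Lambda}[\Lambda^{(\infty)}]$ be the linear epimorphism obtained by restricting the canonical projection $M_{\boldsymbol\Lambda}\to L_{\boldsymbol\Lambda}$. The Gaudin Hamiltonians are $\widetilde H_s=\sum_{r\ne s}\frac{1}{z_s-z_r}(m_sm_r-\Omega_{s,r})$ on $M_{\boldsymbol\Lambda}$, with $\Omega_{s,r}=\sum_{i,j=1}^2e_{ij}^{(s)}e_{ji}^{(r)}$ ($e_{ij}^{(s)}$ acts in the $s$-th factor); $H_s$ is the restriction of $\widetilde H_s$ to $\mathrm{Sing}\,M_{\boldsymbol\Lambda}[\Lambda^{(\infty)}]$. The unital commutative algebra $A_M$ generated by $H_1,\dots,H_n$ preserves $\ker\sigma$; the induced commutative algebra of operators on $\mathrm{Sing}\,L_{\boldsymbol\Lambda}[\Lambda^{(\infty)}]$ is the Bethe algebra $A_L$, and $\psi_{ML}:A_M\to A_L$ is the corresponding epimorphism. Thus $\psi_{ML}(H_s)$ is the operator given by the same formula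 $\sum_{r\ne s}\frac{1}{z_s-z_r}(m_sm_r-\Omega_{s,r})$ acting on $\mathrm{Sing}\,L_{\boldsymbol\Lambda}[\Lambda^{(\infty)}]$. *)

(* Defs.v *)
From HB Require Import structures.
From mathcomp Require Import all_boot all_order all_algebra.
From mathcomp Require Import complex.
From mathcomp Require Import all_classical all_reals all_analysis.

Set Implicit Arguments.
Unset Strict Implicit.
Unset Printing Implicit Defensive.

Import Order.TTheory GRing.Theory Num.Theory.
Import numFieldNormedType.Exports.
Local Open Scope ring_scope.
Local Open Scope classical_set_scope.

(* R[i] itself carries no topology in the library; seen as a numFieldType it
   gets the one of its norm. Differentiating f : Cx R -> Cx R with derivable
   and derive1 is then complex differentiation. *)
Definition Cx (R : realType) : numFieldType := R[i].

Section Gl2Modules.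
Variable K : fieldType.

(* A gl_2-module structure on K^d (column vectors), where E i j is the matrix
   of e_{i+1,j+1}. *)
Definition is_gl2_module (d : nat) (E : 'I_2 -> 'I_2 -> 'M[K]_d) : Prop :=
  forall i j k l : 'I_2,
    E i j *m E k l - E k l *m E i j = E i l *+ (j == k) - E k j *+ (l == i).

Definition is_irreducible (d : nat) (E : 'I_2 -> 'I_2 -> 'M[K]_d) : Prop :=
  (0 < d)%N /\
  forall U : {vspace 'cV[K]_d},
    (forall (i j : 'I_2) (w : 'cV[K]_d), w \in U -> E i j *m w \in U) ->
    U = 0%VS \/ U = fullv.

Definition is_highest_weight_vector (d : nat) (E : 'I_2 -> 'I_2 -> 'M[K]_d)
    (lam1 lam2 : K) (w : 'cV[K]_d) : Prop :=
  [/\ w != 0, E 0 1 *m w = 0, E 0 0 *m w = lam1 *: w & E 1 1 *m w = lam2 *: w].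

(* The irreducible module L_Lambda, Lambda = lam1 epsilon_1 + lam2 epsilon_2,
   is unique up to isomorphism, so it is specified by a predicate. *)
Definition is_irreducible_hw_module (d : nat) (E : 'I_2 -> 'I_2 -> 'M[K]_d)
    (lam1 lam2 : K) : Prop :=
  [/\ is_gl2_module E, is_irreducible E
    & exists w : 'cV[K]_d, is_highest_weight_vector E lam1 lam2 w].

(* K^{d_1} (x) ... (x) K^{d_n}: f stands for the sum over multi-indices k of
   f k times the tensor product of the basis vectors of indices k_1, ..., k_n. *)
Definition tensor_space (n : nat) (d : 'I_n -> nat) : vectType K :=
  {ffun {dffun forall s : 'I_n, 'I_(d s)} -> K^o}.

Definition pure_tensor (n : nat) (d : 'I_n -> nat)
    (w : forall s : 'I_n, 'cV[K]_(d s)) : tensor_space d :=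
  [ffun k : {dffun forall s : 'I_n, 'I_(d s)} => \prod_(s < n) w s (k s) 0].

(* A acting in the s-th factor, see act_at_pure_tensor. *)
Definition act_at (n : nat) (d : 'I_n -> nat) (s : 'I_n) (A : 'M[K]_(d s))
    (f : tensor_space d) : tensor_space d :=
  [ffun k : {dffun forall s : 'I_n, 'I_(d s)} =>
    \sum_(j < d s)
      A (k s) j * f (finfun (dfwith k s j) : {dffun forall s : 'I_n, 'I_(d s)})].

Lemma act_at_pure_tensor (n : nat) (d : 'I_n -> nat) (s : 'I_n)
    (A : 'M[K]_(d s)) (w : forall s : 'I_n, 'cV[K]_(d s)) :
  act_at A (pure_tensor w) = pure_tensor (dfwith w s (A *m w s)).
Proof.
apply/ffunP => k; rewrite !ffunE (bigD1 s) //= dfwithin mxE big_distrl /=.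
apply: eq_bigr => j _; rewrite ffunE (bigD1 s) //= ffunE dfwithin mulrA.
congr (_ * _); apply: eq_bigr => r rs.
by rewrite ffunE !dfwithout // eq_sym.
Qed.

Section TensorProduct.
Variables (n : nat) (d : 'I_n -> nat).
Variable E : forall s : 'I_n, 'I_2 -> 'I_2 -> 'M[K]_(d s).

Definition tensor_act (i j : 'I_2) (v : tensor_space d) : tensor_space d :=
  \sum_(s < n) act_at (E s i j) v.

Definition Sing (l : nat) (v : tensor_space d) : Prop :=
  tensor_act 0 1 v = 0 /\ tensor_act 1 1 v = l%:R *: v.

Definition Omega (s r : 'I_n) (v : tensor_space d) : tensor_space d :=
  \sum_(i < 2) \sum_(j < 2) act_at (E s i j) (act_at (E r j i) v).

Variables (z : 'I_n -> K) (m : 'I_n -> nat).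

(* The operator psi_ML (H_s) induced, through the projection of the tensor
   product of Verma modules onto that of the irreducible modules, by the Gaudin
   Hamiltonian H_s of the former: it is given by the same formula. *)
Definition gaudin_hamiltonian (s : 'I_n) (v : tensor_space d) :
    tensor_space d :=
  \sum_(r < n | r != s)
    (z s - z r)^-1 *: ((m s * m r)%:R *: v - Omega s r v).

(* The unital algebra generated by the psi_ML (H_s). Its elements are written
   as operators on the whole tensor product; the Bethe algebra consists of
   their restrictions to the singular vectors. *)
Inductive bethe_algebra : (tensor_space d -> tensor_space d) -> Prop :=
| bethe_one : bethe_algebra id
| bethe_gen s : bethe_algebra (gaudin_hamiltonian s)
| bethe_add a b : bethe_algebra a -> bethe_algebra b ->
    bethe_algebra (fun v => a v + b v)
| bethe_scale (c : K) a : bethe_algebra a -> bethe_algebra (fun v => c *: a v)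
| bethe_mul a b : bethe_algebra a -> bethe_algebra b -> bethe_algebra (a \o b).

Definition is_bethe_eigenvector (l : nat) (v : tensor_space d) : Prop :=
  [/\ Sing l v, v != 0
    & forall a, bethe_algebra a -> exists c : K, a v = c *: v].

End TensorProduct.
End Gl2Modules.

Section DifferentialEquation.
Variables (R : realType) (n : nat).
Variables (z : 'I_n -> Cx R) (m : 'I_n -> nat) (h : 'I_n -> Cx R).

Definition diff_op (u : Cx R -> Cx R) (x : Cx R) : Cx R :=
  (\prod_(s < n) (x - z s)) *
  (derive1 (derive1 u) x - (\sum_(s < n) (m s)%:R / (x - z s)) * derive1 u x
   + (\sum_(s < n) h s / (x - z s)) * u x).

Definition is_solution_on (U : set (Cx R)) (u : Cx R -> Cx R) : Prop :=
  forall x, U x ->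
    [/\ derivable u x 1, derivable (derive1 u) x 1 & diff_op u x = 0].

(* Solutions are single-valued holomorphic functions on a domain avoiding the
   singular points z_s; on a disconnected set a solution could be a different
   polynomial on each component. *)
Definition all_solutions_polynomial : Prop :=
  forall (U : set (Cx R)) (u : Cx R -> Cx R),
    open U -> connected U -> (forall s : 'I_n, ~ U (z s)) ->
    is_solution_on U u ->
    exists p : {poly Cx R}, forall x, U x -> u x = p.[x].

End DifferentialEquation.

(* Main.v *)
(* The eigenvector is built from separated variables. Power series at an ordinary point show
   that D u = 0 has two independent polynomial solutions f and g, of degrees l and M + 1 - l
   where M = \sum m_s, and, for each i, a solution b_i with b_i(z_i) = 1. With
   S = \prod (x - z_s)^(m_s + 1), the functionals rho_i(p) = Res_(z_i) p b_i / S kill the image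
   of D, because D is self-adjoint for the weight 1 / S up to exact terms, and
   \sum_i f(z_i) rho_i(p) = 0 for deg p < M + n - l - 1 (residue theorem).
   Fix r0 with f(z_r0) <> 0. For |kappa| = l, let phi(kappa) be the multiple residue over the
   variables t_i, i <> r0, of the monomial in Sklyanin's coordinates
   mu_s = \prod_(i <> r0) (z_s - t_i) / \prod_(r <> s) (z_s - z_r). In these coordinates the
   Gaudin Hamiltonians become, by Cramer's rule, combinations of the one-variable operators D
   in the t_i, so killing the image of D makes (phi(kappa)) an eigenvector with eigenvalues h_s.
   The relation given by g makes it singular, the vanishing of rho_i on the multiples of
   (x - z_i)^(m_i + 1) together with the relation given by f lets it descend from the Verma
   modules to the irreducible modules, and it does not vanish because, up to a factor, f gives
   the only relation between the rho_i on polynomials of degree < l + n - 1. *)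
Require Import Defs.
From HB Require Import structures.
From mathcomp Require Import all_boot all_order all_algebra.
From mathcomp Require Import complex.
From mathcomp Require Import ring lra zify.
From mathcomp Require Import all_classical all_reals all_analysis.
Import Order.TTheory GRing.Theory Num.Theory.
Import numFieldNormedType.Exports.
Set Implicit Arguments.
Unset Strict Implicit.
Unset Printing Implicit Defensive.
Local Open Scope ring_scope.

(** * Power series solutions *)

(** The hypothesis on solutions enters only through two polynomial solutions with independent
    initial values at an ordinary point; the rest is algebra, a residue being a coefficient of a
    remainder modulo S. The obstacle is that the change to Sklyanin's variables is a pointwise
    identity in the t_i, whereas phi is made of residue functionals. On polynomials of bounded
    degree, however, a linear functional is a weighted sum of values at chosen nodes. Expanding a
    determinant by rows turns phi(kappa) into a finite sum of monomials in mu over tuples of nodes,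
    with weights independent of kappa, so relations between the values of phi can be checked tuple
    by tuple. One variable is omitted because \sum_s mu_s / (x - z_s) has n - 1 roots when \sum_s
    mu_s = 1. A row of ones takes its place; in Cramer's rule it stands for the equation that the
    differences between the symbols of the Hamiltonians and the h_s sum to zero. Omitting r0 also
    disposes of the relation given by f: as f(z_r0) <> 0, no nonzero multiple of that relation
    avoids rho_r0. *)

Lemma nested_intervals (R : realType) (S e : nat -> R) :
  (forall N, 0 <= e N) -> (forall N, `|S N.+1 - S N| <= e N - e N.+1) ->
  exists s, forall N, `|s - S N| <= e N.
Proof.
move=> e0 dS.
(* The interval of radius [e N] about [S N] contains the next one: left ends increase, right ends
   decrease, and the supremum of the left ends lies in all of them. *)
have Le i k : S i - e i <= S (k + i)%N - e (k + i)%N.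
  elim: k => [//|k IH]; rewrite addSn; have /ler_normlP[] := dS (k + i)%N; lra.
have Ue i k : S (k + i)%N + e (k + i)%N <= S i + e i.
  elim: k => [//|k IH]; rewrite addSn; have /ler_normlP[] := dS (k + i)%N; lra.
have LU i j : S i - e i <= S j + e j.
  have := Le i j; have := Ue j i; have := e0 (i + j)%N; rewrite [(j + i)%N]addnC; lra.
pose L : set R := range (fun N => S N - e N).
have supL : has_sup L.
  split; first by exists (S 0%N - e 0%N), 0%N.
  by exists (S 0%N + e 0%N) => _ [i _ <-]; exact: LU.
exists (sup L) => N; apply/ler_normlP; split.
  have : S N - e N <= sup L by apply: sup_upper_bound => //; exists N.
  lra.
have : sup L <= S N + e N by apply: ge_sup => [|_ [i _ <-]]; [case: supL | exact: LU].
lra.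
Qed.

Lemma geometric_sum_real (R : realType) (c : nat -> R) (B : R) :
  (forall k, `|c k| <= B / 2 ^+ k) ->
  exists s, forall N, `|s - \sum_(k < N) c k| <= 2 * B / 2 ^+ N.
Proof.
move=> cB; have B0 : 0 <= B by have := cB 0%N; have := normr_ge0 (c 0%N); rewrite expr0; lra.
apply: nested_intervals => N; first by rewrite divr_ge0 ?exprn_ge0 ?mulr_ge0.
rewrite big_ord_recr /= addrAC subrr add0r (le_trans (cB N)) // exprS.
suff -> : 2 * B / 2 ^+ N - 2 * B / (2 * 2 ^+ N) = B / 2 ^+ N by [].
by field; rewrite expf_eq0 pnatr_eq0 andbF.
Qed.

Section Cx.
Variable R : realType.
Local Notation K := (Cx R).
Local Open Scope complex_scope.

Lemma Cx_ge0_Re (x : K) : 0 <= x -> x = (complex.Re x)%:C.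
Proof. by case: x => a b; rewrite lecE /= => /andP[/eqP -> _]. Qed.

Lemma Cx_geometric_sum (c : nat -> K) (B : K) :
  (forall k, `|c k| <= B / 2 ^+ k) ->
  exists s, forall N, `|s - \sum_(k < N) c k| <= 4 * B / 2 ^+ N.
Proof.
move=> cB; have B0 : 0 <= B.
  by have := cB 0%N; rewrite expr0 divr1; apply: le_trans.
pose b := complex.Re B; have Bb : B = b%:C by exact: Cx_ge0_Re.
have Bk k : B / 2 ^+ k = (b / 2 ^+ k)%:C :> K.
  by rewrite Bb rmorphM fmorphV rmorphXn /= rmorph_nat.
have cr k : `|complex.Re (c k)| <= b / 2 ^+ k.
  by rewrite -lecR -[leRHS]Bk (le_trans _ (cB k)) // normc_ge_Re.
have ci k : `|complex.Im (c k)| <= b / 2 ^+ k.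
  rewrite -lecR -[leRHS]Bk (le_trans _ (cB k)) //.
  (* Multiplication by i turns the imaginary part into a real part up to sign, so the bound for real
     parts applies. *)
  have -> : `|c k| = `|c k * ('i : R[i])|.
    by rewrite normrM [X in _ * X](_ : _ = 1) ?mulr1 // normc_def /= expr0n add0r expr1n sqrtr1.
  by rewrite -[complex.Im _]opprK -ReiNIm normrN; exact: normc_ge_Re.
have [sr Hr] := geometric_sum_real cr; have [si Hi] := geometric_sum_real ci.
exists (Complex sr si) => N; set S := \sum_(k < N) c k.
have ReS : complex.Re S = \sum_(k < N) complex.Re (c k).
  by rewrite /S (raddf_sum (@complex.Re R)).
have ImS : complex.Im S = \sum_(k < N) complex.Im (c k).
  by rewrite /S (raddf_sum (@complex.Im R)).
have -> : 4 * B / 2 ^+ N = (2 * b / 2 ^+ N + 2 * b / 2 ^+ N)%:C :> K.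
  rewrite rmorphD /= -!mulrA !rmorphM fmorphV rmorphXn /= rmorph_nat -Bb.
  by rewrite -mulrDl -natrD.
rewrite (complexE (_ - _)) (le_trans (ler_normD _ _)) // rmorphD lerD //.
  rewrite normc_def /= expr0n addr0 sqrtr_sqr lecR.
  by rewrite (le_trans _ (Hr N)) // -ReS; case: S {ReS ImS}.
rewrite normrM [X in X * _](_ : _ = 1) ?mul1r; last first.
  by rewrite normc_def /= expr0n add0r expr1n sqrtr1.
rewrite normc_def /= expr0n addr0 sqrtr_sqr lecR.
by rewrite (le_trans _ (Hi N)) // -ImS; case: S {ReS ImS}.
Qed.

Lemma Cx_le_geometric (x y C : K) : 0 <= x -> 0 <= y ->
  (forall N, x <= y + C / 2 ^+ N) -> x <= y.
Proof.
move=> x0 y0 H.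
(* The order of [Cx R] only compares numbers with a real difference, so the inequality at N = 0
   forces [C] to be real; the Archimedean property of [R] does the rest. *)
have C0 : C \is Num.real.
  have := H 0%N; rewrite expr0 divr1 -subr_ge0 => /ger0_real h.
  have -> : C = y + C - x + x - y by ring.
  by apply: rpredB (ger0_real y0); apply: rpredD h (ger0_real x0).
have Cb : C = (complex.Re C)%:C by move/RRe_real: C0.
move: H; rewrite (Cx_ge0_Re x0) (Cx_ge0_Re y0) Cb.
set a := complex.Re x; set b := complex.Re y; set c := complex.Re C => H.
rewrite lecR leNgt; apply/negP => ba.
have Hr N : a <= b + c / 2 ^+ N.
  by rewrite -lecR rmorphD rmorphM fmorphV rmorphXn /= rmorph_nat.
pose N := Num.bound `|c / (a - b)|.
have ab : 0 < a - b by rewrite subr_gt0.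
have : c / (a - b) < 2 ^+ N.
  apply: (le_lt_trans (ler_norm _)); apply: (@lt_le_trans _ _ N%:R).
    by rewrite archi_boundP.
  by rewrite -natrX ler_nat ltnW // ltn_expl.
rewrite ltr_pdivrMr //; have := Hr N.
rewrite -lerBlDl ler_pdivlMr ?exprn_gt0 // mulrC => h1 h2.
by have := le_lt_trans h1 h2; rewrite mulrC ltxx.
Qed.

End Cx.

Section GeometricSums.
Variable R : realType.
Local Notation K := (Cx R).

(* Sums of series with a geometric rate of convergence; the explicit rate replaces any
   topology on [Cx R], whose completeness is only used through [Cx_geometric_sum]. *)
Definition gsum (c : nat -> K) (s : K) : Prop :=
  exists C, forall N, `|s - \sum_(k < N) c k| <= C / 2 ^+ N.

Lemma gsum_exists (c : nat -> K) (B : K) :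
  (forall k, `|c k| <= B / 2 ^+ k) -> exists s, gsum c s.
Proof. by move=> /Cx_geometric_sum[s H]; exists s, (4 * B). Qed.

Lemma gsum_ext (c d : nat -> K) s : c =1 d -> gsum c s -> gsum d s.
Proof.
by move=> cd [C H]; exists C => N; under eq_bigr do rewrite -cd.
Qed.

Lemma gsumD (c d : nat -> K) s t :
  gsum c s -> gsum d t -> gsum (fun k => c k + d k) (s + t).
Proof.
move=> [C H] [D H']; exists (C + D) => N.
rewrite big_split /= opprD addrACA mulrDl (le_trans (ler_normD _ _)) //.
exact: lerD (H N) (H' N).
Qed.

Lemma gsumZ (x : K) (c : nat -> K) s : gsum c s -> gsum (fun k => x * c k) (x * s).
Proof.
move=> [C H]; exists (`|x| * C) => N.
by rewrite -mulr_sumr -mulrBr normrM -mulrA ler_wpM2l // H.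
Qed.

Definition shift_seq (c : nat -> K) (k : nat) : K := if k is k'.+1 then c k' else 0.

Lemma gsum_shift (c : nat -> K) s : gsum c s -> gsum (shift_seq c) s.
Proof.
move=> [C H]; exists (2 * C) => -[|N].
  have /le_trans := H 0%N; rewrite !big_ord0 !expr0 !divr1; apply.
  have C0 : 0 <= C by have := H 0%N; rewrite expr0 divr1; exact: le_trans.
  by rewrite mulr_natl mulr2n lerDl.
rewrite big_ord_recl /= add0r exprS (le_trans (H N)) // -mulf_div divff ?mul1r //.
Qed.

Lemma gsum_le (c : nat -> K) s (B : K) :
  (forall k, `|c k| <= B / 2 ^+ k) -> gsum c s -> `|s| <= 2 * B.
Proof.
move=> cB [C H]; have B0 : 0 <= B.
  by have := cB 0%N; rewrite expr0 divr1; apply: le_trans.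
apply: (@Cx_le_geometric R _ _ C) => // [|N]; first by rewrite mulr_ge0.
rewrite -[s](subrK (\sum_(k < N) c k)) addrC (le_trans (ler_normD _ _)) // (lerD _ (H N)) //.
apply: le_trans (ler_norm_sum _ _ _) _; apply: le_trans (_ : 2 * B * (1 - 2^-1 ^+ N) <= _).
  elim: N => [|N IH]; first by rewrite big_ord0 expr0 subrr mulr0.
  rewrite big_ord_recr /=; apply: (le_trans (lerD IH (cB N))).
  rewrite exprS -exprVn [leLHS](_ : _ = 2 * B * (1 - 2^-1 * 2^-1 ^+ N)) //.
  by field.
by rewrite ler_piMr ?mulr_ge0 // lerBlDr lerDl exprn_ge0.
Qed.

Lemma gsum_unique (c : nat -> K) s t : gsum c s -> gsum c t -> s = t.
Proof.
move=> cs ct; apply/eqP; rewrite -subr_eq0 -normr_le0.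
rewrite -[leRHS](mulr0 2) -mulN1r.
apply: (@gsum_le (fun k => c k + (-1) * c k)) (gsumD cs (gsumZ (-1) ct)) => k.
by rewrite mulN1r subrr normr0 mul0r.
Qed.

Lemma gsum1 (c : nat -> K) : (forall k, c k.+1 = 0) -> gsum c (c 0%N).
Proof.
move=> c0; exists `|c 0%N| => -[|N]; first by rewrite big_ord0 subr0 expr0 divr1.
rewrite big_ord_recl big1 /= => [|i _]; last by rewrite c0.
by rewrite addr0 subrr normr0 divr_ge0 // exprn_ge0.
Qed.

Definition psum (a : nat -> K) (w s : K) : Prop := gsum (fun k => a k * w ^+ k) s.

Definition diff_seq (a : nat -> K) (k : nat) : K := k.+1%:R * a k.+1.

Definition poly_conv (p : {poly K}) (a : nat -> K) (k : nat) : K :=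
  \sum_(j < k.+1) p`_j * a (k - j)%N.

Lemma poly_conv_MXaddC (p : {poly K}) c a k :
  poly_conv (p * 'X + c%:P) a k = shift_seq (poly_conv p a) k + c * a k.
Proof.
rewrite /poly_conv big_ord_recl /= coefD coefMX coefC eqxx add0r subn0 addrC; congr (_ + _).
case: k => [|k] /=; first by rewrite big_ord0.
by apply: eq_bigr => j _; rewrite subSS coefD coefMX coefC /= addr0.
Qed.

Lemma psum_poly_conv (p : {poly K}) (a : nat -> K) (w s : K) :
  psum a w s -> psum (poly_conv p a) w (p.[w] * s).
Proof.
move=> aws; elim/poly_ind: p => [|p c IH].
  rewrite horner0 mul0r; have := gsumZ 0 aws; rewrite mul0r; apply: gsum_ext => k.
  by rewrite /poly_conv big1 ?mul0r // => j _; rewrite coef0 mul0r.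
rewrite hornerMXaddC mulrDl mulrAC.
have := gsumD (gsum_shift (gsumZ w IH)) (gsumZ c aws); rewrite mulrC; apply: gsum_ext.
move=> k; rewrite poly_conv_MXaddC mulrDl mulrA; congr (_ + _).
by case: k => [|k] /=; rewrite ?mul0r // exprS mulrCA.
Qed.

(** The remainder satisfies R_(k+1) = (w + h) R_k + k w^(k-1) h^2, and k^2 + k <= (k+1)^2 closes the
    induction. The factor [d ^+ 2] on the left avoids the exponent k - 2 on the right. *)
Lemma power_taylor (w h d : K) k : `|w| <= d -> `|w + h| <= d ->
  d ^+ 2 * `|(w + h) ^+ k - w ^+ k - h * (k%:R * w ^+ k.-1)|
    <= (k ^ 2)%:R * d ^+ k * `|h| ^+ 2.
Proof.
move=> wd whd; have d0 : 0 <= d by apply: le_trans wd.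
elim: k => [|k IH]; first by rewrite !expr0 subrr mul0r mulr0 subr0 normr0 mulr0 !mul0r.
have -> : (w + h) ^+ k.+1 - w ^+ k.+1 - h * (k.+1%:R * w ^+ k) =
  (w + h) * ((w + h) ^+ k - w ^+ k - h * (k%:R * w ^+ k.-1)) + k%:R * w ^+ k.-1 * h ^+ 2.
  case: k {IH} => [|k] /=; first by rewrite !expr0 !expr1; ring.
  by rewrite !exprS -!natr1; ring.
apply: le_trans (_ : d * ((k ^ 2)%:R * d ^+ k * `|h| ^+ 2)
    + k%:R * d ^+ k.+1 * `|h| ^+ 2 <= _); last first.
  rewrite [leLHS](_ : _ = (k ^ 2 + k)%:R * d ^+ k.+1 * `|h| ^+ 2); last first.
    by rewrite natrD (exprS d k); ring.
  by rewrite !ler_wpM2r ?exprn_ge0 // ler_nat; nia.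
rewrite (le_trans (ler_wpM2l _ (ler_normD _ _))) ?exprn_ge0 // mulrDr lerD //.
  rewrite normrM mulrCA; apply: ler_pM => //; first by rewrite mulr_ge0 ?exprn_ge0.
rewrite !normrM normr_nat !normrX.
rewrite [leLHS](_ : _ = k%:R * (d ^+ 2 * `|w| ^+ k.-1) * `|h| ^+ 2); last by ring.
rewrite ler_wpM2r ?exprn_ge0 //.
case: k {IH} => [|k] /=; first by rewrite !mul0r.
by rewrite ler_wpM2l // -[k.+2]addn2 addnC exprD ler_wpM2l ?exprn_ge0 // lerXn2r.
Qed.

Lemma psum_taylor (a : nat -> K) (B rho d w h s s' s1 : K) :
  (forall k, `|a k| <= B * rho ^+ k) -> 0 <= rho -> 8 * rho * d <= 1 ->
  `|w| <= d -> `|w + h| <= d ->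
  psum a w s -> psum a (w + h) s' -> psum (diff_seq a) w s1 ->
  d ^+ 2 * `|s' - s - h * s1| <= 2 * (B * `|h| ^+ 2).
Proof.
move=> aB rho0 rd wd whd as_ as' as1; have d0 : 0 <= d by apply: le_trans wd.
have B0 : 0 <= B by have := aB 0%N; rewrite expr0 mulr1; apply: le_trans.
rewrite -[X in X * _ <= _]ger0_norm ?exprn_ge0 // -normrM.
pose e k := d ^+ 2 * (a k * ((w + h) ^+ k - w ^+ k - h * (k%:R * w ^+ k.-1))).
apply: (@gsum_le e) => [k|].
  rewrite /e normrM normrX (ger0_norm d0) normrM mulrCA.
  apply: le_trans (ler_pM _ _ (aB k) (power_taylor k wd whd)) _ => //.
    by rewrite mulr_ge0 // exprn_ge0.
  (* The origin of the 8 in the hypothesis: it absorbs k^2 <= 4^k from the remainder and 2^k from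
     the rate of convergence. *)
  have k4 : (k ^ 2)%:R * (2 : K) ^+ k <= 8 ^+ k.
    rewrite -!natrX -natrM ler_nat (_ : 8 ^ k = 4 ^ k * 2 ^ k)%N; last by rewrite -expnMn.
    by rewrite leq_mul2r -[4%N]/(2 ^ 2)%N -expnM mulnC expnM leq_exp2r // ltnW ?orbT // ltn_expl.
  rewrite ler_pdivlMr ?exprn_gt0 //.
  rewrite [leLHS](_ : _ = B * `|h| ^+ 2 * (((k ^ 2)%:R * 2 ^+ k) * (rho * d) ^+ k)); last first.
    by rewrite exprMn; ring.
  rewrite ler_piMr ?mulr_ge0 ?exprn_ge0 //.
  apply: le_trans (_ : 8 ^+ k * (rho * d) ^+ k <= _).
    by rewrite ler_wpM2r ?exprn_ge0 ?mulr_ge0.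
  by rewrite -exprMn mulrA exprn_ile1 ?mulr_ge0.
have := gsumZ (d ^+ 2) (gsumD (gsumD as' (gsumZ (-1) as_)) (gsumZ (- h) (gsum_shift as1))).
rewrite mulN1r mulNr; apply: gsum_ext => k; rewrite /e mulN1r.
by case: k => [|k] /=; rewrite /diff_seq ?expr0; ring.
Qed.
End GeometricSums.

(** * Formal power series solutions and their growth *)

Section OdeSeries.
Variable R : realType.
Local Notation K := (Cx R).

Lemma strong_recursion (G : nat -> (nat -> K) -> K) :
  (forall n g h, (forall i, (i < n)%N -> g i = h i) -> G n g = G n h) ->
  exists a : nat -> K, forall n, a n = G n a.
Proof.
move=> Gext.
pose hist := fix hist n : seq K :=
  if n is n'.+1 then rcons (hist n') (G n' (nth 0 (hist n'))) else [::].
have szh n : size (hist n) = n by elim: n => //= n IH; rewrite size_rcons IH.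
pose a n := G n (nth 0 (hist n)).
have nth_hist n i : (i < n)%N -> nth 0 (hist n) i = a i.
  elim: n => // n IH; rewrite ltnS leq_eqVlt /= nth_rcons szh => /orP[/eqP ->|ni].
    by rewrite ltnn eqxx.
  by rewrite ni IH.
by exists a => n; rewrite /a; apply: Gext => i /nth_hist.
Qed.

Lemma sum_norm_coef_bounded (p : {poly K}) :
  exists2 P : K, 0 <= P & forall k, \sum_(j < k) `|p`_j| <= P.
Proof.
exists (\sum_(j < size p) `|p`_j|) => [|k]; first exact: sumr_ge0.
have [kp|kp] := leqP k (size p).
  rewrite -(subnKC kp) big_split_ord /= lerDl; exact: sumr_ge0.
rewrite -(subnKC (ltnW kp)) big_split_ord /= [X in _ + X]big1 ?addr0 // => j _.
by rewrite nth_default ?normr0 // leq_addr.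
Qed.

Lemma poly_conv_bounded (p : {poly K}) : exists2 P : K, 0 <= P &
  forall (b : nat -> K) (s : K) k, (forall i, (i <= k)%N -> `|b i| <= s) ->
    `|poly_conv p b k| <= P * s.
Proof.
have [P P0 HP] := sum_norm_coef_bounded p; exists P => // b s k bs.
have s0 : 0 <= s by apply: le_trans (bs k _).
apply: le_trans (ler_norm_sum _ _ _) _.
apply: le_trans (_ : \sum_(j < k.+1) `|p`_j| * s <= _).
  by apply: ler_sum => j _; rewrite normrM ler_wpM2l // bs // leq_subr.
by rewrite -mulr_suml ler_wpM2r.
Qed.

Lemma poly_conv_ext (p : {poly K}) b c k :
  (forall i, (i <= k)%N -> b i = c i) -> poly_conv p b k = poly_conv p c k.
Proof. by move=> bc; apply: eq_bigr => j _; rewrite bc // leq_subr. Qed.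

Lemma geometric_growth (a : nat -> K) (C : K) : 0 <= C ->
  (forall k, `|a k.+2| <= C * \sum_(i < k.+2) `|a i|) ->
  forall k, `|a k| <= (`|a 0%N| + `|a 1%N|) * (1 + C) ^+ k.
Proof.
move=> C0 H k; have C1 : 1 <= 1 + C by rewrite lerDl.
have sB n : \sum_(i < n.+2) `|a i| <= (`|a 0%N| + `|a 1%N|) * (1 + C) ^+ n.+1.
  elim: n => [|n IH].
    by rewrite !big_ord_recl big_ord0 addr0 expr1 ler_peMr // addr_ge0.
  rewrite big_ord_recr /=; apply: le_trans (lerD (lexx _) (H n)) _.
  rewrite -[X in X + _]mul1r -mulrDl exprS mulrCA ler_wpM2l //.
  by apply: le_trans C1.
case: k => [|k]; first by rewrite expr0 mulr1 lerDl.
apply: le_trans (sB k); rewrite big_ord_recr /= lerDr; exact: sumr_ge0.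
Qed.

Lemma ode_series (p q r : {poly K}) (alpha beta : K) : p`_0 != 0 ->
  exists a B rho, [/\ 1 <= rho, a 0%N = alpha, a 1%N = beta,
    forall k, `|a k| <= B * rho ^+ k &
    forall k, poly_conv p (diff_seq (diff_seq a)) k + poly_conv q (diff_seq a) k
      + poly_conv r a k = 0].
Proof.
(* The induction serves as a case split p = p1 X + c with c nonzero: the term of c contributes c
   (k+2)(k+1) a_(k+2), all others involve earlier coefficients only. *)
elim/poly_ind: p => [|p1 c _]; first by rewrite coef0 eqxx.
rewrite coefD coefMX coefC !eqxx /= add0r => c0.
pose rest k (g : nat -> K) := shift_seq (poly_conv p1 (diff_seq (diff_seq g))) k
  + poly_conv q (diff_seq g) k + poly_conv r g k.
pose G n g := match n with
  | 0 => alpha | 1 => beta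
  | k.+2 => - (rest k g / (c * k.+2%:R * k.+1%:R)) end.
have restext k g h : (forall i, (i < k.+2)%N -> g i = h i) -> rest k g = rest k h.
  move=> gh; rewrite /rest; congr (_ + _ + _); last 2 first.
  - by apply: poly_conv_ext => i ik; rewrite /diff_seq gh.
  - by apply: poly_conv_ext => i ik; rewrite gh // ltnS leqW.
  case: k gh => [|k] gh //=; apply: poly_conv_ext => i ik.
  by rewrite /diff_seq gh // !ltnS leqW.
have [n g h gh|a Ha] := @strong_recursion G.
  by case: n gh => [|[|k]] gh //=; rewrite (restext _ _ _ gh).
have [P1 P10 HP1] := poly_conv_bounded p1.
have [Q Q0 HQ] := poly_conv_bounded q; have [S S0 HS] := poly_conv_bounded r.
pose C := (P1 + Q + S) / `|c|.
have C0 : 0 <= C by rewrite divr_ge0 // !addr_ge0.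
(* The divisor (k+2)(k+1) outweighs the factors brought in by two differentiations, so the growth is
   geometric and not factorial. *)
have growth k : `|a k.+2| <= C * \sum_(i < k.+2) `|a i|.
  pose s : K := \sum_(i < k.+2) `|a i|; rewrite -/s.
  have as_ i : (i < k.+2)%N -> `|a i| <= s.
    move=> ik; rewrite /s (bigD1 (Ordinal ik)) //= lerDl; exact: sumr_ge0.
  have s0 : 0 <= s by apply: sumr_ge0.
  pose t := k.+2%:R * k.+1%:R * s.
  have kt : 1 <= k.+1%:R :> K by rewrite ler1n.
  have kt2 : 1 <= k.+2%:R :> K by rewrite ler1n.
  have t1 : k.+1%:R * s <= t by rewrite /t -mulrA ler_peMl // mulr_ge0.
  have t0 : s <= t by apply: le_trans t1; rewrite ler_peMl.
  rewrite Ha /= normrN normrM normfV ler_pdivrMr ?normr_gt0 ?mulf_neq0 ?pnatr_eq0 //.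
  rewrite !normrM !normr_nat /C.
  rewrite [leRHS](_ : _ = (P1 + Q + S) * t); last first.
    have E (x y v v' s' : K) : x != 0 -> y / x * s' * (x * v * v') = y * (v * v' * s').
      by move=> x0; field.
    by apply: E; rewrite normr_eq0.
  rewrite !mulrDl; apply: le_trans (ler_normD _ _) (lerD _ _).
    apply: le_trans (ler_normD _ _) (lerD _ _).
  - case: (k) as_ @t kt kt2 t1 t0 => [|k'] as_ t kt kt2 t1 t0 /=.
      by rewrite normr0 mulr_ge0 // (le_trans s0).
    apply: HP1 => i ik; rewrite /diff_seq !normrM !normr_nat /t mulrA ler_pM ?mulr_ge0 //.
      by rewrite mulrC ler_pM // ler_nat ltnS // leqW.
    by apply: as_; rewrite !ltnS.
  - apply: HQ => i ik; rewrite /diff_seq normrM normr_nat; apply: le_trans t1.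
    by rewrite ler_pM ?ler_nat ?ltnS // as_.
  - by apply: HS => i ik; apply: le_trans (as_ _ _) t0; rewrite ltnS leqW.
exists a, (`|a 0%N| + `|a 1%N|), (1 + C); split; rewrite ?lerDl ?(Ha 0%N) ?(Ha 1%N) //.
  by move=> k; have := geometric_growth C0 growth k; rewrite (Ha 0%N) (Ha 1%N).
move=> k; rewrite poly_conv_MXaddC.
suff : rest k a + c * diff_seq (diff_seq a) k = 0 by rewrite /rest => <-; ring.
rewrite /diff_seq (Ha k.+2) /=; field.
by rewrite c0 nat1r -natrD !pnatr_eq0.
Qed.

End OdeSeries.

(** * Holomorphic solutions near an ordinary point *)

Section LocalSolutions.
Variable R : realType.
Local Notation K := (Cx R).
Local Open Scope classical_set_scope.

Lemma quadratic_is_derive (u : K -> K) (x d delta C : K) : 0 < delta -> 0 <= C ->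
  (forall h, `|h| <= delta -> `|u (x + h) - u x - h * d| <= C * `|h| ^+ 2) ->
  is_derive x 1 u d.
Proof.
move=> delta0 C0 H.
suff cvgu : (fun h : K => h^-1 *: ((u \o shift x) (h *: (1 : K)) - u x)) @ 0^' --> d.
  by apply: DeriveDef; [apply/cvg_ex; exists d | exact: (cvg_lim (@norm_hausdorff _ _) cvgu)].
apply/cvgrPdistC_le => eps eps0.
have C1 : 0 < C + 1 by rewrite ltr_wpDl.
near=> h.
have h0 : h != 0 by near: h; exact: nbhs_dnbhs_neq.
have hd : `|h| <= delta.
  near: h; apply: dnbhs0_le; exact: delta0.
have he : `|h| <= eps / (C + 1).
  near: h; apply: dnbhs0_le; exact: divr_gt0.
rewrite /= /shift /= (_ : h *: 1 = h) ?[h + x]addrC; last by rewrite /GRing.scale /= mulr1.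
have -> : h^-1 *: (u (x + h) - u x) - d = h^-1 * (u (x + h) - u x - h * d).
  by rewrite /GRing.scale /=; field.
rewrite normrM normfV mulrC ler_pdivrMr ?normr_gt0 // (le_trans (H _ hd)) //.
rewrite expr2 mulrA ler_wpM2r //; apply: le_trans (_ : (C + 1) * `|h| <= _).
  by rewrite ler_wpM2r // lerDl.
by rewrite mulrC -ler_pdivlMr.
Unshelve. all: by end_near. Qed.

Lemma diff_seq_bounded (a : nat -> K) (B rho : K) : 0 <= rho ->
  (forall k, `|a k| <= B * rho ^+ k) ->
  forall k, `|diff_seq a k| <= B * rho * (2 * rho) ^+ k.
Proof.
move=> rho0 aB k; have B0 : 0 <= B.
  by have := aB 0%N; rewrite expr0 mulr1; apply: le_trans.
rewrite normrM normr_nat (le_trans (ler_wpM2l _ (aB _))) // exprS exprMn.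
rewrite [leRHS](_ : _ = 2 ^+ k * (B * (rho * rho ^+ k))); last by ring.
by rewrite ler_wpM2r ?mulr_ge0 ?exprn_ge0 // -natrX ler_nat ltn_expl.
Qed.

Lemma psum_exists (a : nat -> K) (B rho w : K) : 0 <= rho ->
  (forall k, `|a k| <= B * rho ^+ k) -> 2 * rho * `|w| <= 1 -> exists s, psum a w s.
Proof.
move=> rho0 aB rw; apply: (@gsum_exists _ _ B) => k; have B0 : 0 <= B.
  by have := aB 0%N; rewrite expr0 mulr1; apply: le_trans.
rewrite normrM normrX ler_pdivlMr ?exprn_gt0 //.
apply: le_trans (_ : B * rho ^+ k * `|w| ^+ k * 2 ^+ k <= _).
  by rewrite !ler_wpM2r ?exprn_ge0.
rewrite [leLHS](_ : _ = B * (2 * rho * `|w|) ^+ k); last by rewrite !exprMn; ring.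
by rewrite ler_piMr // exprn_ile1 ?mulr_ge0.
Qed.

Lemma psum_is_derive (a : nat -> K) (B rho d x0 : K) (u u1 : K -> K) :
  0 <= rho -> (forall k, `|a k| <= B * rho ^+ k) -> 8 * rho * d <= 1 ->
  (forall x, `|x - x0| <= d -> psum a (x - x0) (u x)) ->
  (forall x, `|x - x0| <= d -> psum (diff_seq a) (x - x0) (u1 x)) ->
  forall x, `|x - x0| < d -> is_derive x 1 u (u1 x).
Proof.
move=> rho0 aB rd ua u1a x xd.
have B0 : 0 <= B by have := aB 0%N; rewrite expr0 mulr1; apply: le_trans.
have d0 : 0 < d by apply: le_lt_trans xd.
apply: (@quadratic_is_derive _ _ _ (d - `|x - x0|) (2 * B / d ^+ 2)) => [||h hd].
- by rewrite subr_gt0.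
- by rewrite divr_ge0 ?mulr_ge0 ?exprn_ge0 // ltW.
have xhd : `|x - x0 + h| <= d.
  by rewrite (le_trans (ler_normD _ _)) // -lerBrDl.
have := psum_taylor aB rho0 rd (ltW xd) xhd (ua _ (ltW xd)) _ (u1a _ (ltW xd)).
move/(_ (u (x + h))); rewrite [x - x0 + h]addrAC => /(_ (ua _ _)) T.
rewrite [leRHS](_ : _ = 2 * (B * `|h| ^+ 2) / d ^+ 2); last by ring.
by rewrite ler_pdivlMr ?exprn_gt0 // mulrC; apply: T; rewrite addrAC.
Qed.

Lemma ode_local_solution (p q r : {poly K}) (x0 alpha beta : K) : p.[x0] != 0 ->
  exists (d : K) (u u1 u2 : K -> K), [/\ 0 < d, u x0 = alpha, u1 x0 = beta &
    forall x, `|x - x0| < d -> [/\ is_derive x 1 u (u1 x), is_derive x 1 u1 (u2 x) &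
      p.[x] * u2 x + q.[x] * u1 x + r.[x] * u x = 0]].
Proof.
move=> px0; pose tr (s : {poly K}) := s \Po ('X + x0%:P).
have trE s x : (tr s).[x - x0] = s.[x].
  by rewrite horner_comp hornerD hornerX hornerC subrK.
have ptr0 : (tr p)`_0 != 0.
  by rewrite -horner_coef0 -[X in _.[X]](subrr x0) trE.
have [a [B [rho [rho1 a0 a1 aB aode]]]] := ode_series (tr q) (tr r) alpha beta ptr0.
have rho_gt0 : 0 < rho by apply: lt_le_trans rho1.
have rho0 := ltW rho_gt0.
have aB1 := diff_seq_bounded rho0 aB.
have rho20 : 0 <= 2 * rho by rewrite mulr_ge0.
have rho40 : 0 <= 2 * (2 * rho) by rewrite mulr_ge0.
have aB2 := diff_seq_bounded rho20 aB1.
(* Each differentiation doubles the ratio of the coefficient bound. Differentiating [u1], of ratio 2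
   rho, requires 8 (2 rho) d <= 1, whence the 16. *)
pose d := (16 * rho)^-1.
have d0 : 0 < d by rewrite invr_gt0 mulr_gt0.
have rd : 16 * rho * d = 1 by rewrite divff // mulf_neq0 // gt_eqF.
have ex b (C s : K) : 0 <= s -> s <= 4 * rho -> (forall k, `|b k| <= C * s ^+ k) ->
    exists u : K -> K, forall x, `|x - x0| <= d -> psum b (x - x0) (u x).
  move=> s0 s4 bC.
  have H x : exists y, `|x - x0| <= d -> psum b (x - x0) y.
    have [xd|] := boolP (`|x - x0| <= d); last by exists 0.
    have sx : 2 * s * `|x - x0| <= 1.
      apply: le_trans (_ : 2 * (4 * rho) * d <= _).
        by rewrite ler_pM ?mulr_ge0 // ler_wpM2l.
      by rewrite -[leRHS]rd ler_wpM2r ?(ltW d0) // mulrA ler_wpM2r // -natrM ler_nat.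
    by have [y Hy] := psum_exists s0 bC sx; exists y.
  by have [u Hu] := choice H; exists u.
have le24 : 2 * rho <= 4 * rho by rewrite ler_wpM2r // ler_nat.
have le14 : rho <= 4 * rho by rewrite ler_peMl // ler1n.
have le44 : 2 * (2 * rho) <= 4 * rho by rewrite mulrA -natrM.
have [u Hu] := ex _ _ _ rho0 le14 aB.
have [u1 Hu1] := ex _ _ _ rho20 le24 aB1.
have [u2 Hu2] := ex _ _ _ rho40 le44 aB2.
have at0 b c : psum b (x0 - x0) c -> c = b 0%N.
  rewrite subrr => bc; apply: (gsum_unique bc).
  have := @gsum1 R (fun k => b k * 0 ^+ k); rewrite expr0 mulr1; apply => k.
  by rewrite exprS mul0r mulr0.
have xx0 : `|x0 - x0| <= d by rewrite subrr normr0 ltW.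
exists d, u, u1, u2; split => //.
- by rewrite (at0 _ _ (Hu _ xx0)).
- by rewrite (at0 _ _ (Hu1 _ xx0)) /diff_seq a1 mul1r.
move=> x xd; split.
- apply: (psum_is_derive rho0 aB _ Hu Hu1 xd).
  by rewrite -[leRHS]rd ler_wpM2r ?(ltW d0) // ler_wpM2r // ler_nat.
- apply: (psum_is_derive rho20 aB1 _ Hu1 Hu2 xd).
  by rewrite -[leRHS]rd mulrA -natrM.
have xd' := ltW xd.
rewrite -!(trE _ x).
have := gsumD (gsumD (psum_poly_conv (tr p) (Hu2 _ xd')) (psum_poly_conv (tr q) (Hu1 _ xd')))
  (psum_poly_conv (tr r) (Hu _ xd')).
move/gsum_unique; apply; have := @gsum1 R (fun _ => 0) (fun _ => erefl); apply: gsum_ext => k.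
by rewrite -!mulrDl aode mul0r.
Qed.

(** The disc is a union of segments from its centre, each a continuous image of the real interval
    [0, 1]. Norms in [Cx R] are themselves complex numbers, hence the passage to real parts in the
    estimate. *)
Lemma Cx_ball_connected (x0 d : K) : 0 < d -> connected [set x : K | `|x - x0| < d].
Proof.
move=> d0; set U := [set x : K | _].
pose seg (y : K) := (fun t : R => x0 + (t%:C)%C * (y - x0)) @` `[0, 1].
have -> : U = \bigcup_(y in U) seg y.
  apply/seteqP; split => [y Uy | x [y Uy [t]]] /=.
    by exists y => //; exists 1; rewrite /= ?in_itv /= ?ler01 ?lexx // mul1r addrC subrK.
  rewrite in_itv /= => /andP[t0 t1] <-; rewrite /U /= addrAC subrr add0r normrM.
  rewrite ger0_norm ?ler0c //; apply: le_lt_trans Uy.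
  by rewrite ler_piMl // -[1]/((1%:C)%C) lecR.
apply: bigcup_connected => [|y Uy].
  exists x0 => y Uy; exists 0; rewrite /= ?in_itv /= ?ler01 ?lexx //.
  by rewrite mul0r addr0.
apply: connected_continuous_connected; first exact: segment_connected.
apply: continuous_subspaceT => t.
apply/cvgrPdist_le => eps eps0.
pose e := complex.Re eps / (complex.Re `|y - x0| + 1).
have epsE : eps = ((complex.Re eps)%:C)%C by apply: Cx_ge0_Re; exact: ltW.
have yE : `|y - x0| = ((complex.Re `|y - x0|)%:C)%C by apply: Cx_ge0_Re.
have re0 : 0 < complex.Re eps by rewrite -ltcR -epsE.
have ry0 : 0 <= complex.Re `|y - x0| by rewrite -ler0c -yE.
have e0 : 0 < e by rewrite divr_gt0 // ltr_wpDl.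
near=> s.
have ts : `|t - s| <= e by near: s; apply: cvgr_dist_le.
rewrite opprD addrACA subrr add0r -mulrBl normrM -rmorphB /=.
rewrite [X in X * _](_ : _ = (`|t - s|%:C)%C); last first.
  by rewrite normc_def /= expr0n addr0 sqrtr_sqr.
rewrite yE epsE -rmorphM lecR.
apply: le_trans (_ : e * (complex.Re `|y - x0| + 1) <= _).
  by rewrite ler_pM // lerDl.
by rewrite /e divfK // gt_eqF // ltr_wpDl.
Unshelve. all: by end_near. Qed.

End LocalSolutions.

Lemma poly_eq0_of_injective_roots (F : idomainType) (p : {poly F}) (x : nat -> F) :
  injective x -> (forall k, p.[x k] = 0) -> p = 0.
Proof.
move=> xinj px; apply/eqP; apply: contraT => p0.
have rs : all (root p) (mkseq x (size p)) by apply/allP => _ /mapP[k _ ->]; apply/rootP.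
have := max_poly_roots p0 rs; rewrite size_mkseq ltnn; apply.
by rewrite map_inj_uniq ?iota_uniq.
Qed.

Section Oper.
Variables (K : fieldType) (n : nat) (z : 'I_n -> K) (m : 'I_n -> nat) (h : 'I_n -> K).

Definition nodal : {poly K} := \prod_(s < n) ('X - (z s)%:P).

Definition nodal_at (s : 'I_n) : {poly K} := \prod_(r < n | r != s) ('X - (z r)%:P).

(** The operator D_h with its denominators cleared, so that it maps polynomials to polynomials and
    makes sense at the z_s. *)
Definition oper (u : {poly K}) : {poly K} :=
  nodal * u^`()^`() - (\sum_(s < n) (m s)%:R *: nodal_at s) * u^`()
    + (\sum_(s < n) h s *: nodal_at s) * u.

Lemma nodalE s : nodal = ('X - (z s)%:P) * nodal_at s.
Proof. by rewrite /nodal (bigD1 s). Qed.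

Lemma horner_nodal_at s x : x != z s -> (nodal_at s).[x] = nodal.[x] / (x - z s).
Proof.
by move=> xs; rewrite (nodalE s) hornerM hornerXsubC mulrC mulKf // subr_eq0.
Qed.

Lemma horner_sum_nodal_at (c : 'I_n -> K) x : (forall s, x != z s) ->
  (\sum_(s < n) c s *: nodal_at s).[x] = nodal.[x] * \sum_(s < n) c s / (x - z s).
Proof.
move=> xz; rewrite horner_sum mulr_sumr; apply: eq_bigr => s _.
by rewrite hornerZ horner_nodal_at // mulrCA.
Qed.

End Oper.

Section PolynomialSolutions.
Variable R : realType.
Local Notation K := (Cx R).
Local Open Scope classical_set_scope.

Lemma is_derive_polynomial (p : {poly K}) (x : K) :
  is_derive x 1 (horner p) p^`().[x].
Proof.
elim/poly_ind: p => [|p c IH].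
  rewrite deriv0 horner0 (_ : horner 0 = cst 0); last by apply/funext => y; rewrite horner0.
  exact: is_derive_cst.
rewrite (_ : horner _ = (horner p * id) + cst c); last first.
  by apply/funext => y; rewrite hornerMXaddC.
apply: (is_derive_eq (is_deriveD (is_deriveM IH (is_derive_id _ _)) (is_derive_cst _ _ _))).
by rewrite derivMXaddC hornerD hornerMX /GRing.scale /= mulr1 addr0 mulrC.
Qed.

(** The local solution with these initial values is polynomial on a small disc by hypothesis; the
    equation then holds at infinitely many points, hence as an identity of polynomials. *)
Lemma polynomial_solution (n : nat) (z : 'I_n -> K) (m : 'I_n -> nat) (h : 'I_n -> K)
    (x0 alpha beta : K) :
  all_solutions_polynomial z m h -> (forall s, z s != x0) ->
  exists p : {poly K}, [/\ p.[x0] = alpha, p^`().[x0] = beta & oper z m h p = 0].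
Proof.
move=> allpoly zx0.
pose q := - \sum_(s < n) (m s)%:R *: nodal_at z s.
pose r := \sum_(s < n) h s *: nodal_at z s.
have qE x : (forall s, x != z s) ->
    q.[x] = - ((nodal z).[x] * \sum_(s < n) (m s)%:R / (x - z s)).
  by move=> xz; rewrite /q hornerN (horner_sum_nodal_at (fun s => (m s)%:R) xz).
have rE x : (forall s, x != z s) ->
    r.[x] = (nodal z).[x] * \sum_(s < n) h s / (x - z s).
  by move=> xz; exact: horner_sum_nodal_at.
have nod0 : (nodal z).[x0] != 0.
  rewrite horner_prod prodf_seq_neq0; apply/allP => s _.
  by rewrite hornerXsubC subr_eq0 eq_sym zx0.
have [d [u [u1 [u2 [d0 u0 u10 H]]]]] := ode_local_solution q r alpha beta nod0.
(* The reciprocal of a sum of reciprocals is below each term: the disc of radius [e] lies in the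
   domain of [u] and avoids every z_s. *)
pose e := (d^-1 + \sum_(s < n) `|x0 - z s|^-1)^-1.
have S0 : 0 <= \sum_(s < n) `|x0 - z s|^-1 by apply: sumr_ge0 => s _; rewrite invr_ge0.
have e0 : 0 < e by rewrite invr_gt0 ltr_pwDl // invr_gt0.
have ed : e <= d by rewrite -[leRHS]invrK lef_pV2 ?posrE ?invr_gt0 ?ltr_pwDl ?invr_gt0 // lerDl.
have xz s : 0 < `|x0 - z s| by rewrite normr_gt0 subr_eq0 eq_sym.
have ez s : e <= `|x0 - z s|.
  rewrite -[leRHS]invrK lef_pV2 ?posrE ?invr_gt0 ?ltr_pwDl ?invr_gt0 //.
  rewrite (bigD1 s) //= addrCA lerDl addr_ge0 //; first by rewrite invr_ge0 ltW.
  by apply: sumr_ge0 => t _; rewrite invr_ge0.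
pose U := [set x : K | `|x - x0| < e].
have UE : U = ball x0 e.
  by rewrite -ball_normE; apply/seteqP; split => x /=; rewrite distrC.
have Uopen : open U by rewrite UE; exact: ball_open.
have Ux x : U x -> \forall y \near x, U y.
  by move=> ux; exact: (open_nbhs_nbhs (conj Uopen ux)).
have Uz s : ~ U (z s).
  by rewrite /U /= distrC => /lt_le_trans /(_ (ez s)); rewrite ltxx.
have Ud x : U x -> `|x - x0| < d by move=> /lt_le_trans; apply.
have du x : U x -> is_derive x 1 u (u1 x) by move=> /Ud /H[].
have du1 x : U x -> is_derive x 1 u1 (u2 x) by move=> /Ud /H[].
have d1u x : U x -> derive1 u x = u1 x.
  by move=> /du ?; rewrite derive1E derive_val.
have d2u x : U x -> is_derive x 1 (derive1 u) (u2 x).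
  move=> ux; apply: near_eq_is_derive (du1 _ ux).
  by apply: filterS (Ux _ ux) => y /d1u.
have [p Hp] : exists p : {poly K}, forall x, U x -> u x = p.[x].
  apply: (allpoly U u) => // [|x ux].
    exact: Cx_ball_connected.
  split.
  - exact: (@ex_derive _ _ _ _ _ _ _ (du _ ux)).
  - exact: (@ex_derive _ _ _ _ _ _ _ (d2u _ ux)).
  have [_ _ Hx] := H _ (Ud _ ux); move: Hx.
  have xzs s : x != z s by apply/eqP => xs; apply: (Uz s); rewrite -xs.
  rewrite /diff_op d1u // derive1E (@derive_val _ _ _ _ _ _ _ (d2u _ ux)) => Hx.
  rewrite -[in RHS]Hx -(_ : (nodal z).[x] = \prod_(s < n) (x - z s)); last first.
    by rewrite horner_prod; apply: eq_bigr => s _; rewrite hornerXsubC.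
  rewrite qE // rE //.
  have E (a b c v w t : K) : a * (v - b * w + c * t) = a * v + - (a * b) * w + a * c * t.
    by ring.
  exact: E.
have Hp1 x : U x -> u1 x = p^`().[x].
  move=> ux; rewrite -[LHS](@derive_val _ _ _ _ _ _ _ (du _ ux)).
  rewrite (near_eq_derive (g := horner p));
      first exact: (@derive_val _ _ _ _ _ _ _ (is_derive_polynomial p x)).
  by apply: filterS (Ux _ ux) => y /Hp.
have Hp2 x : U x -> u2 x = p^`()^`().[x].
  move=> ux; rewrite -[LHS](@derive_val _ _ _ _ _ _ _ (du1 _ ux)).
  rewrite (near_eq_derive (g := horner p^`()));
      first exact: (@derive_val _ _ _ _ _ _ _ (is_derive_polynomial _ x)).
  by apply: filterS (Ux _ ux) => y /Hp1.
have Ux0 : U x0 by rewrite /U /= subrr normr0.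
exists p; rewrite -Hp // -Hp1 //; split => //.
apply: (@poly_eq0_of_injective_roots _ _ (fun k => x0 + e / k.+2%:R)) => [i j /addrI|k].
  move/(mulfI (lt0r_neq0 e0))/invr_inj/eqP; rewrite eqr_nat => /eqP; lia.
have : U (x0 + e / k.+2%:R).
  rewrite /U /= addrAC subrr add0r ger0_norm ?divr_ge0 ?ltW // ltr_pdivrMr //.
  by rewrite ltr_pMr // ltr1n.
move: (x0 + _) => x ux; have [_ _] := H _ (Ud _ ux).
by rewrite (Hp _ ux) (Hp1 _ ux) (Hp2 _ ux) /q /r hornerN mulNr /oper !(hornerM, hornerD, hornerN).
Qed.

End PolynomialSolutions.

(** * The operator on polynomials *)

Lemma coefM_top (R : comNzRingType) (p q : {poly R}) a b :
  (size p <= a.+1)%N -> (size q <= b.+1)%N -> (p * q)`_(a + b) = p`_a * q`_b.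
Proof.
move=> pa qb; rewrite coefM.
have la : (a < (a + b).+1)%N by rewrite ltnS leq_addr.
rewrite (bigD1 (Ordinal la)) //= addKn big1 ?addr0 // => i ia.
have [ia'|ai] := ltnP a i; first by rewrite (nth_default _ (leq_trans pa ia')) mul0r.
have ia' : (i < a)%N.
  by rewrite ltn_neqAle ai andbT; apply: contra ia => /eqP ia; apply/eqP/val_inj.
by rewrite [q`_ _]nth_default ?mulr0 // (leq_trans qb) //; lia.
Qed.

Section NodalTheory.
Variables (K : fieldType) (n : nat) (z : 'I_n -> K).
Local Notation A := (nodal z).

Lemma nodal_monic : A \is monic.
Proof. exact: monic_prod_XsubC. Qed.

Lemma size_nodal : size A = n.+1.
Proof. by rewrite size_prod_XsubC [index_enum _]unlock -enumT size_enum_ord. Qed.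

Lemma nodal_at_monic s : nodal_at z s \is monic.
Proof. exact: monic_prod_XsubC. Qed.

Lemma size_nodal_at s : size (nodal_at z s) = n.
Proof.
apply/eqP; rewrite -eqSS -size_nodal (nodalE z s) size_monicM ?monicXsubC //.
  by rewrite size_XsubC.
exact: monic_neq0 (nodal_at_monic s).
Qed.

Lemma coef_nodal_at_top s : (nodal_at z s)`_n.-1 = 1.
Proof. by have /monicP := nodal_at_monic s; rewrite lead_coefE size_nodal_at. Qed.

Lemma size_sum_nodal_at (c : 'I_n -> K) :
  (size (\sum_(s < n) c s *: nodal_at z s)%R <= n)%N.
Proof.
apply: leq_trans (size_sum _ _ _) _; apply/bigmax_leqP => s _.
by apply: leq_trans (size_scale_leq _ _) _; rewrite size_nodal_at.
Qed.

Lemma nodal_at_eq0 s r : r != s -> (nodal_at z s).[z r] = 0.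
Proof.
move=> rs; rewrite /nodal_at (bigD1 r) //= hornerM hornerXsubC subrr mul0r //.
Qed.

Lemma mulX_sum_nodal_at (c : 'I_n -> K) :
  'X * (\sum_(s < n) c s *: nodal_at z s) =
    (\sum_(s < n) c s) *: A + \sum_(s < n) (z s * c s) *: nodal_at z s.
Proof.
rewrite mulr_sumr scaler_suml -big_split /=; apply: eq_bigr => s _.
rewrite (nodalE z s) -!mul_polyC !polyCM; ring.
Qed.

Lemma sum_nodal_at_mod (c : 'I_n -> K) i : exists q,
  \sum_(s < n) c s *: nodal_at z s = c i *: nodal_at z i + ('X - (z i)%:P) * q.
Proof.
exists (\sum_(s < n | s != i) c s *: \prod_(r < n | (r != s) && (r != i)) ('X - (z r)%:P)).
rewrite (bigD1 i) //= mulr_sumr; congr (_ + _); apply: eq_bigr => s si.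
by rewrite -scalerAr /nodal_at (bigD1 i) //= eq_sym.
Qed.

Hypothesis z_inj : injective z.

Lemma nodal_at_neq0 s : (nodal_at z s).[z s] != 0.
Proof.
rewrite horner_prod prodf_seq_neq0; apply/allP => r _; apply/implyP => rs.
by rewrite hornerXsubC subr_eq0; apply: contra rs => /eqP/z_inj ->.
Qed.

Lemma interpolation (p : {poly K}) : (size p <= n)%N ->
  p = \sum_(s < n) (p.[z s] / (nodal_at z s).[z s]) *: nodal_at z s.
Proof.
move=> pn; apply/eqP; rewrite -subr_eq0; apply: contraT => d0.
set d := p - _ in d0 *.
have dn : (size d <= n)%N.
  by rewrite (leq_trans (size_polyD _ _)) // geq_max pn size_polyN size_sum_nodal_at.
have dz s : root d (z s).
  rewrite /root /d hornerD hornerN horner_sum (bigD1 s) //= big1 => [|r rs].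
    by rewrite hornerZ divfK ?nodal_at_neq0 // addr0 subrr.
  have sr : s != r by rewrite eq_sym.
  by rewrite hornerZ [X in _ * X]nodal_at_eq0 ?mulr0.
have rs : all (root d) [seq z s | s <- enum 'I_n] by apply/allP => _ /mapP[s _ ->].
have us : uniq [seq z s | s <- enum 'I_n] by rewrite map_inj_uniq ?enum_uniq.
by have := max_poly_roots d0 rs us; rewrite size_map size_enum_ord ltnNge dn.
Qed.

Lemma interpolation_top (p : {poly K}) : (size p <= n)%N ->
  \sum_(s < n) p.[z s] / (nodal_at z s).[z s] = p`_n.-1.
Proof.
move=> pn; rewrite [in RHS](interpolation pn) coef_sum; apply: eq_bigr => s _.
by rewrite coefZ coef_nodal_at_top mulr1.
Qed.

End NodalTheory.

Section OperTheory.
Variables (K : numFieldType) (n : nat) (z : 'I_n -> K) (m : 'I_n -> nat) (h : 'I_n -> K).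
Local Notation A := (nodal z).
Local Notation B := (\sum_(s < n) (m s)%:R *: nodal_at z s).
Local Notation M := (\sum_(s < n) m s)%N.
Local Notation D := (oper z m h).

Lemma operD u v : D (u + v) = D u + D v.
Proof. rewrite /oper !derivD; ring. Qed.

Lemma operZ c u : D (c *: u) = c *: D u.
Proof. rewrite /oper !derivZ -!mul_polyC; ring. Qed.

Lemma oper_sum (I : Type) (r : seq I) (P : pred I) (F : I -> {poly K}) :
  D (\sum_(i <- r | P i) F i) = \sum_(i <- r | P i) D (F i).
Proof.
elim/big_rec2: _ => [|i y x _ <-]; last by rewrite operD.
by rewrite /oper !linear0 !mulr0 subr0 addr0.
Qed.

(** The indicial polynomial at infinity; \sum h_s = 0 removes the contribution of one degree higher.
    The factor ['X] avoids the truncated exponent n + k - 2. *)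
Lemma oper_top (u : {poly K}) k : (0 < n)%N -> \sum_(s < n) h s = 0 ->
  (size u <= k.+1)%N ->
  ('X * D u)`_(n.-1 + k) =
    (k%:R * (k%:R - 1 - M%:R) + \sum_(s < n) z s * h s) * u`_k.
Proof.
move=> n0 h0 uk.
have -> : 'X * D u = A * ('X * u^`()^`()) - B * ('X * u^`())
    + ('X * \sum_(s < n) h s *: nodal_at z s) * u by rewrite /oper; ring.
rewrite mulX_sum_nodal_at h0 scale0r add0r coefD coefB.
have sB c : (size (\sum_(s < n) c s *: nodal_at z s)%R <= n.-1.+1)%N.
  by rewrite prednK // size_sum_nodal_at.
have cB c : (\sum_(s < n) c s *: nodal_at z s)`_n.-1 = \sum_(s < n) c s.
  by rewrite coef_sum; apply: eq_bigr => s _; rewrite coefZ coef_nodal_at_top mulr1.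
have XdE (v : {poly K}) : ('X * v^`())`_k = k%:R * v`_k.
  by rewrite coefXM; case: k {uk} => [|k]; rewrite ?mul0r // coef_deriv mulr_natl.
have sXd (v : {poly K}) : (size v <= k.+1)%N -> (size ('X * v^`())%R <= k.+1)%N.
  move=> vk; apply/leq_sizeP => j kj; rewrite coefXM.
  case: j kj => [//|j] kj /=; rewrite coef_deriv nth_default ?mul0rn //.
  exact: leq_trans kj.
have -> : (A * ('X * u^`()^`()))`_(n.-1 + k) = k%:R * (k%:R - 1) * u`_k.
  case: k uk {XdE sXd} => [|k] uk.
    rewrite mul0r mul0r (_ : u^`()^`() = 0) ?mulr0 ?coef0 //.
    by rewrite (size1_polyC uk) derivC linear0.
  rewrite -(_ : (n + k)%N = (n.-1 + k.+1)%N); last by rewrite addnS -addSn prednK.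
  rewrite coefM_top ?size_nodal // ?coefXM.
    have /monicP := nodal_monic z; rewrite lead_coefE size_nodal => ->.
    case: k uk => [|k] uk; first by rewrite eqxx mulr0 subrr mulr0 mul0r.
    have -> : k.+2%:R - 1 = k.+1%:R :> K by rewrite -natr1 addrK.
    by rewrite /= !coef_deriv mul1r -mulrnA -natrM mulr_natl.
  apply/leq_sizeP => j kj; rewrite coefXM; case: j kj => [//|j] kj /=.
  by rewrite !coef_deriv (nth_default _ (_ : (_ <= j.+2)%N)) ?mul0rn // (leq_trans uk).
rewrite !coefM_top ?sB ?sXd // (cB (fun s => (m s)%:R)) (cB (fun s => z s * h s)) XdE.
rewrite natr_sum; ring.
Qed.

(** The indicial polynomial at z_i: for the exponent e = k + 1 it is e (e - 1 - m_i) up to a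
    constant, with roots 0 and m_i + 1. *)
Lemma oper_local (i : 'I_n) (r : {poly K}) k : exists t,
  D (('X - (z i)%:P) ^+ k.+1 * r) = ('X - (z i)%:P) ^+ k * t /\
  t.[z i] = k.+1%:R * (k%:R - (m i)%:R) * (nodal_at z i).[z i] * r.[z i].
Proof.
have [b Hb] := sum_nodal_at_mod z (fun s => (m s)%:R) i.
have [c Hc] := sum_nodal_at_mod z h i.
rewrite /oper Hb Hc (nodalE z i); set y := 'X - _; set a := nodal_at z i.
have dy : y^`() = 1 by rewrite derivXsubC.
exists (a * ((k.+1 * k)%:R%:P * r + 2 * k.+1%:R%:P * y * r^`() + y ^+ 2 * r^`()^`())
  - ((m i)%:R%:P * a + y * b) * (k.+1%:R%:P * r + y * r^`())
  + (h i *: a + y * c) * y * r).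
split.
  have dyk j : (y ^+ j.+1)^`() = j.+1%:R%:P * y ^+ j.
    by rewrite deriv_exp dy mul1r -mulr_natl polyC_natr.
  rewrite derivM dyk derivD !derivM derivC mul0r add0r dyk natrM polyCM.
  have yd : y * (y ^+ k)^`() = k%:R%:P * y ^+ k.
    case: k => [|k]; first by rewrite expr0 derivC mulr0 mul0r.
    by rewrite dyk exprS; ring.
  clear Hb Hc dyk dy; rewrite -!mul_polyC !exprS; clearbody y a.
  move: ((y ^+ k)^`()) (y ^+ k) yd => w Y yd; move: (r^`()^`()) => r2.
  move: (r^`()) (m i)%:R%:P ((h i)%:P) k.+1%:R%:P k%:R%:P yd => r1 mu eta k1 k0 yd.
  ring: yd.
have yi : y.[z i] = 0 by rewrite /y hornerXsubC subrr.
clearbody y; rewrite natrM polyCM !(hornerD, hornerN, hornerM, hornerC, hornerZ, horner_exp, yi).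
rewrite !(mul0r, mulr0, addr0, expr0n) -!natr1; ring.
Qed.

(** At the exponent m_i + 1 the indicial polynomial vanishes, which restores the one power of x -
    z_i that the operator loses. *)
Lemma oper_ideal i u : ('X - (z i)%:P) ^+ (m i).+1 %| u ->
  ('X - (z i)%:P) ^+ (m i).+1 %| D u.
Proof.
move=> /dvdpP[r ->]; rewrite mulrC; have [t [-> t0]] := oper_local i r (m i).
rewrite exprSr dvdp_mul2l ?expf_neq0 ?polyXsubC_eq0 // dvdp_XsubCl.
by rewrite /root t0 subrr mulr0 !mul0r.
Qed.

End OperTheory.

(** * Degrees and orders of polynomial solutions *)

Section Solutions.
Variables (K : numFieldType) (n : nat) (z : 'I_n -> K) (m : 'I_n -> nat) (h : 'I_n -> K).
Variable l : nat.
Local Notation A := (nodal z).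
Local Notation M := (\sum_(s < n) m s)%N.
Local Notation D := (oper z m h).
Hypothesis z_inj : injective z.
Hypothesis dominant : (2 * l <= M)%N.
Hypothesis h_sum : \sum_(s < n) h s = 0.
Hypothesis zh_sum : \sum_(s < n) z s * h s = l%:R * (M%:R + 1 - l%:R).
Hypothesis n_gt0 : (0 < n)%N.

(** The value of \sum z_s h_s makes the indicial polynomial at infinity factor as (k - l)(k - (M - l
    + 1)). *)
Lemma solution_size (u : {poly K}) : u != 0 -> D u = 0 ->
  size u = l.+1 \/ size u = (M - l).+2.
Proof.
move=> u0 Du; have sE : size u = (size u).-1.+1 by rewrite prednK // size_poly_gt0.
set k := (size u).-1 in sE.
have := oper_top z m n_gt0 h_sum (eq_leq sE); rewrite Du mulr0 coef0 zh_sum => /esym/eqP.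
have lM : (l <= M)%N by lia.
have -> : k%:R * (k%:R - 1 - M%:R) + l%:R * (M%:R + 1 - l%:R)
    = (k%:R - l%:R) * (k%:R - (M - l).+1%:R) :> K.
  by rewrite -natr1 natrB //; ring.
rewrite mulf_eq0 -/(lead_coef u) (negbTE (_ : lead_coef u != 0)) ?lead_coef_eq0 // orbF.
by rewrite mulf_eq0 !subr_eq0 !eqr_nat sE => /orP[] /eqP ->; [left|right].
Qed.

(** Subtracting the multiple of [f] with the same coefficient of degree l leaves a solution of
    degree below l, hence also below M - l + 1 by dominance: it is zero. *)
Lemma solution_unique (f u : {poly K}) : D f = 0 -> size f = l.+1 ->
  D u = 0 -> (size u <= (M - l).+1)%N -> exists c, u = c *: f.
Proof.
move=> Df sf Du su; exists (u`_l / f`_l); apply/eqP; rewrite -subr_eq0; apply: contraT => d0.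
have fl : f`_l != 0.
  by have := lead_coef_eq0 f; rewrite lead_coefE sf /= => ->; rewrite -size_poly_eq0 sf.
have ul : (size u <= l.+1)%N.
  have [->|u0] := eqVneq u 0; first by rewrite size_poly0.
  by case: (solution_size u0 Du) => su'; rewrite su' // in su *; move: su; rewrite ltnn.
have Dd : D (u - (u`_l / f`_l) *: f) = 0.
  by rewrite -scaleNr operD operZ Du Df scaler0 addr0.
have sd : (size (u - (u`_l / f`_l) *: f)%R <= l)%N.
  apply/leq_sizeP => j; rewrite leq_eqVlt => /orP[/eqP <-|lj].
    by rewrite coefB coefZ divfK // subrr.
  by rewrite coefB coefZ [u`_j]nth_default ?(leq_trans ul) // [f`_j]nth_default ?sf // mulr0 subr0.
by case: (solution_size d0 Dd) => sd'; move: sd; rewrite sd'; lia.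
Qed.

Lemma solution_order i (u : {poly K}) : u != 0 -> D u = 0 -> u.[z i] = 0 ->
  exists2 r, r.[z i] != 0 & u = r * ('X - (z i)%:P) ^+ (m i).+1.
Proof.
move=> u0 Du uz; have [k [r]] := multiplicity_XsubC u (z i).
rewrite u0 /= => rz; case: k => [|k] uE.
  by move: uz rz; rewrite uE expr0 mulr1 /root => ->; rewrite eqxx.
exists r => //; rewrite uE; congr (_ * _ ^+ _.+1).
have [t [Dt tz]] := oper_local z m h i r k; move: Dt; rewrite mulrC -uE Du.
move/esym/eqP; rewrite mulf_eq0 expf_eq0 polyXsubC_eq0 andbF /= => /eqP t0.
move/esym/eqP: tz; rewrite t0 horner0 !mulf_eq0 pnatr_eq0 /=.
rewrite (negbTE (nodal_at_neq0 z_inj i)) (negbTE (rz : r.[z i] != 0)) !orbF subr_eq0 eqr_nat.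
by move/eqP.
Qed.

Lemma solution_dvd i (u : {poly K}) : D u = 0 -> u.[z i] = 0 ->
  ('X - (z i)%:P) ^+ (m i).+1 %| u.
Proof.
have [->|u0] := eqVneq u 0; first by rewrite dvdp0.
by move=> Du uz; have [r _ ->] := solution_order u0 Du uz; rewrite dvdp_mull.
Qed.

Section TwoSolutions.
Variables (x0 : K) (p1 p2 : {poly K}).
Hypothesis Dp1 : D p1 = 0.
Hypothesis Dp2 : D p2 = 0.
Hypothesis p1_x0 : p1.[x0] = 1.
Hypothesis dp1_x0 : p1^`().[x0] = 0.
Hypothesis p2_x0 : p2.[x0] = 0.
Hypothesis dp2_x0 : p2^`().[x0] = 1.

Lemma combination_eq0 a b : a *: p1 + b *: p2 = 0 -> a = 0 /\ b = 0.
Proof.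
move=> H; split.
  have : (a *: p1 + b *: p2).[x0] = 0 by rewrite H horner0.
  by rewrite hornerD !hornerZ p1_x0 p2_x0 mulr0 mulr1 addr0.
have : (a *: p1 + b *: p2)^`().[x0] = 0 by rewrite H linear0 horner0.
by rewrite derivD !derivZ hornerD !hornerZ dp1_x0 dp2_x0 mulr0 mulr1 add0r.
Qed.

Lemma combination_solution a b : D (a *: p1 + b *: p2) = 0.
Proof. by rewrite operD !operZ Dp1 Dp2 !scaler0 addr0. Qed.

(** One linear condition on a two-dimensional space of solutions. Cancelling the coefficient at one
    admissible degree forces the other degree. *)
Lemma exists_solution_coef0 j : exists u, [/\ u != 0, D u = 0 & u`_j = 0].
Proof.
have [a [b [ab0 Hab]]] : exists a b,
    ((a != 0) || (b != 0)) /\ (a *: p1 + b *: p2)`_j = 0.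
  have [p2l|p2l] := eqVneq p2`_j 0.
    by exists 0, 1; rewrite oner_eq0 orbT scale0r add0r scale1r.
  exists 1, (- p1`_j / p2`_j); rewrite oner_eq0; split => //.
  by rewrite coefD !coefZ divfK // mul1r subrr.
exists (a *: p1 + b *: p2); split => //; last exact: combination_solution.
by apply/eqP => /combination_eq0[a0 b0]; rewrite a0 b0 eqxx in ab0.
Qed.

Lemma exists_solutions : exists f g : {poly K},
  [/\ D f = 0, D g = 0, size f = l.+1 & size g = (M - l).+2].
Proof.
have lead0 (u : {poly K}) j : u != 0 -> u`_j = 0 -> size u != j.+1.
  move=> u0 uj; apply: contra u0 => /eqP su.
  by rewrite -lead_coef_eq0 lead_coefE su /= uj.
have [g [g0 Dg gl]] := exists_solution_coef0 l.
have [f [f0 Df fl]] := exists_solution_coef0 (M - l).+1.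
exists f, g; split => //.
  by case: (solution_size f0 Df) => // sf; have := lead0 _ _ f0 fl; rewrite sf eqxx.
by case: (solution_size g0 Dg) => // sg; have := lead0 _ _ g0 gl; rewrite sg eqxx.
Qed.

(** If [p1] and [p2] both vanished at z_i, both would have order m_i + 1 there, and the combination
    cancelling their lowest coefficients would be a nonzero solution of still higher order. *)
Lemma exists_nonvanishing_solution i : exists b, D b = 0 /\ b.[z i] = 1.
Proof.
have [p1z|p1z] := eqVneq p1.[z i] 0; last first.
  exists (p1.[z i]^-1 *: p1); rewrite operZ Dp1 scaler0 hornerZ mulVf //.
have [p2z|p2z] := eqVneq p2.[z i] 0; last first.
  exists (p2.[z i]^-1 *: p2); rewrite operZ Dp2 scaler0 hornerZ mulVf //.
exfalso.
have p10 : p1 != 0.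
  by apply/eqP => p0; move/eqP: p1_x0; rewrite p0 horner0 eq_sym oner_eq0.
have p20 : p2 != 0.
  by apply/eqP => p0; move/eqP: dp2_x0; rewrite p0 linear0 horner0 eq_sym oner_eq0.
have [r1 r1z E1] := solution_order p10 Dp1 p1z; have [r2 r2z E2] := solution_order p20 Dp2 p2z.
have [u0|u0] := eqVneq (r2.[z i] *: p1 + (- r1.[z i]) *: p2) 0.
  by have [/eqP] := combination_eq0 u0; rewrite (negbTE r2z).
have Du := combination_solution r2.[z i] (- r1.[z i]).
have uz : (r2.[z i] *: p1 + (- r1.[z i]) *: p2).[z i] = 0.
  by rewrite hornerD !hornerZ p1z p2z !mulr0 addr0.
have [r rz] := solution_order u0 Du uz; rewrite E1 E2 !scalerAl -mulrDl => /mulIf rE.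
move: rz; rewrite -rE ?expf_neq0 ?polyXsubC_eq0 //.
by rewrite hornerD !hornerZ mulrC mulNr subrr eqxx.
Qed.

End TwoSolutions.
End Solutions.

(** * Residues *)

Lemma size_mul_leq (R : nzRingType) (p q : {poly R}) a b :
  (size p <= a)%N -> (size q <= b)%N -> (size (p * q)%R <= (a + b).-1)%N.
Proof.
move=> pa qb; apply: leq_trans (size_polyMleq _ _) _.
by rewrite -!subn1 leq_sub2r // leq_add.
Qed.

Section Residues.
Variables (K : numFieldType) (n : nat) (z : 'I_n -> K) (m : 'I_n -> nat) (h : 'I_n -> K).
Local Notation A := (nodal z).
Local Notation B := (\sum_(s < n) (m s)%:R *: nodal_at z s).
Local Notation M := (\sum_(s < n) m s)%N.
Local Notation D := (oper z m h).
Local Notation y i := ('X - (z i)%:P).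
Hypothesis z_inj : injective z.

Definition sing : {poly K} := \prod_(s < n) y s ^+ (m s).+1.

Lemma sing_monic : sing \is monic.
Proof. by apply: monic_prod => s _; rewrite monic_exp // monicXsubC. Qed.

Lemma size_sing : size sing = (M + n).+1.
Proof.
rewrite size_prod => [|s _]; last by rewrite expf_neq0 // polyXsubC_eq0.
under eq_bigr do rewrite size_exp_XsubC.
rewrite (eq_bigr (fun s => m s + 2)%N) => [|s _]; last by rewrite addn2.
by rewrite big_split /= sum_nat_const card_ord; lia.
Qed.

Lemma coprime_powers i j : i != j -> coprimep (y i ^+ (m i).+1) (y j ^+ (m j).+1).
Proof.
move=> ij; rewrite coprimep_expl // coprimep_expr // coprimep_XsubC2 // subr_eq0.
by apply: contra ij => /eqP/z_inj ->.
Qed.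

Lemma coprime_other_powers i :
  coprimep (y i ^+ (m i).+1) (\prod_(s < n | s != i) y s ^+ (m s).+1).
Proof.
elim/big_rec: _ => [|s p si IH]; first exact: coprimep1.
by rewrite coprimepMr IH coprime_powers // eq_sym.
Qed.

Lemma sing_dvdP u : (forall i, y i ^+ (m i).+1 %| u) -> sing %| u.
Proof.
move=> H; rewrite /sing.
have: forall r : seq 'I_n, uniq r -> \prod_(s <- r) y s ^+ (m s).+1 %| u.
  elim=> [|i r IH] /=; first by rewrite big_nil dvd1p.
  move=> /andP[ir ur]; rewrite big_cons Gauss_dvdp ?H ?IH //.
  rewrite big_seq; elim/big_rec: _ => [|s p sr IHp]; first exact: coprimep1.
  rewrite coprimepMr IHp coprime_powers //.
  by apply: contraNneq ir => ->.
by apply; rewrite index_enum_uniq.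
Qed.

Lemma dvd_sing i : y i ^+ (m i).+1 %| sing.
Proof. by rewrite /sing (bigD1 i) //= dvdp_mulIl. Qed.

Lemma root_sing i : root sing (z i).
Proof.
by rewrite -dvdp_XsubCl (dvdp_trans _ (dvd_sing i)) // exprS dvdp_mulIl.
Qed.

(* The sum of all the residues of [G / sing], minus the residue at infinity. *)
Definition total_residue (G : {poly K}) : K := (G %% sing)`_(M + n).-1.

Lemma total_residueD G H : total_residue (G + H) = total_residue G + total_residue H.
Proof. by rewrite /total_residue modpD coefD. Qed.

Lemma total_residueZ c G : total_residue (c *: G) = c * total_residue G.
Proof. by rewrite /total_residue modpZl coefZ. Qed.

Lemma total_residue_sum (I : Type) (r : seq I) (P : pred I) (F : I -> {poly K}) :
  total_residue (\sum_(i <- r | P i) F i) = \sum_(i <- r | P i) total_residue (F i).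
Proof.
elim/big_rec2: _ => [|i x G _ <-]; last by rewrite total_residueD.
by rewrite /total_residue mod0p coef0.
Qed.

Lemma total_residue_dvd G : sing %| G -> total_residue G = 0.
Proof. by move/modp_eq0; rewrite /total_residue => ->; rewrite coef0. Qed.

Lemma total_residue_eq G H : sing %| G - H -> total_residue G = total_residue H.
Proof.
move=> GH; rewrite -[G](subrK H) total_residueD total_residue_dvd ?add0r //.
Qed.

Lemma total_residue_small (G : {poly K}) : (size G <= M + n)%N -> total_residue G = G`_(M + n).-1.
Proof. by move=> sG; rewrite /total_residue modp_small // size_sing. Qed.

Lemma nodal_dlog : A * (\prod_(s < n) y s ^+ m s)^`() = B * \prod_(s < n) y s ^+ m s.
Proof.
elim/big_rec2: _ => [|s w c _ IH]; first by rewrite derivC mulr0 mul0r.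
have ys : A * (y s ^+ m s)^`() = ((m s)%:R *: nodal_at z s) * y s ^+ m s.
  rewrite (nodalE z s) deriv_exp derivXsubC mul1r -mul_polyC polyC_natr -mulr_natl.
  by case: (m s) => [|k]; rewrite ?mul0r ?mulr0 // exprS /=; ring.
rewrite derivM mulrDr mulrA ys mulrCA IH; ring.
Qed.

(* [A w' - B w = A W (w / W)'] with [W = \prod_s (X - z_s) ^ m_s], so that dividing it by
   [sing = A W] yields a derivative, which has no residues. *)
Lemma total_residue_derivative w : total_residue (A * w^`() - B * w) = 0.
Proof.
pose W := \prod_(s < n) y s ^+ m s.
have sW : size W = M.+1.
  rewrite size_prod => [|s _]; last by rewrite expf_neq0 // polyXsubC_eq0.
  under eq_bigr do rewrite size_exp_XsubC.
  rewrite (eq_bigr (fun s => m s + 1)%N) => [|s _]; last by rewrite addn1.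
  by rewrite big_split /= sum_nat_const card_ord; lia.
have singE : sing = W * A.
  by rewrite /sing /W /nodal -big_split; apply: eq_bigr => s _; rewrite exprSr.
rewrite (divp_eq w W); set q := w %/ W; set r := w %% W.
have -> : A * (q * W + r)^`() - B * (q * W + r) = sing * q^`() + (A * r^`() - B * r).
  rewrite derivD derivM singE mulrDr [A * (_ + _)]mulrDr [A * (q * _)]mulrCA nodal_dlog -/W.
  by ring.
rewrite total_residueD total_residue_dvd ?dvdp_mulIl // add0r.
have sr : (size r <= M)%N.
  by rewrite -ltnS -sW ltn_modp -size_poly_eq0 sW.
have [r0|r0] := eqVneq r 0.
  by rewrite r0 linear0 !mulr0 subr0 total_residue_dvd ?dvdp0.
have M_gt0 : (0 < M)%N by apply: leq_trans sr; rewrite size_poly_gt0.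
have sd : (size (A * r^`() - B * r)%R <= (M + n).-1)%N.
  rewrite (leq_trans (size_polyD _ _)) // size_polyN geq_max; apply/andP; split.
    have sr' : (size r^`() <= M.-1)%N.
      have : (size r^`() < M)%N := leq_trans (lt_size_deriv r0) sr.
      by case: M => // k; rewrite ltnS.
    by apply: leq_trans (size_mul_leq (eq_leq (size_nodal z)) sr') _; lia.
  apply: leq_trans (size_mul_leq (size_sum_nodal_at z (fun s => (m s)%:R)) sr) _; lia.
by rewrite total_residue_small ?nth_default // (leq_trans sd) // leq_pred.
Qed.

(** Lagrange's identity: the two products differ by A w' - B w with w = p' q - p q'. *)
Lemma oper_adjoint p q : total_residue (D p * q) = total_residue (p * D q).
Proof.
have -> : D p * q = p * D q +
    (A * (p^`() * q - p * q^`())^`() - B * (p^`() * q - p * q^`())).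
  rewrite /oper derivB !derivM; ring.
by rewrite total_residueD total_residue_derivative addr0.
Qed.

Lemma oper_sing u : sing %| u -> sing %| D u.
Proof.
by move=> su; apply: sing_dvdP => i; apply: oper_ideal; apply: dvdp_trans su; exact: dvd_sing.
Qed.

Lemma size_oper (u : {poly K}) k : (0 < n)%N -> (size u <= k.+1)%N -> (size (D u) <= n + k)%N.
Proof.
move=> n0 uk; have B1 := size_sum_nodal_at z (fun s => (m s)%:R).
have H1 := size_sum_nodal_at z h.
have size_d j (v : {poly K}) : (size v <= j)%N -> (size v^`() <= j.-1)%N.
  move=> vj; apply/leq_sizeP => i ji; rewrite coef_deriv nth_default ?mul0rn //.
  by apply: leq_trans vj _; lia.
have u1 := size_d _ _ uk; have u2 := size_d _ _ u1.
rewrite /oper; apply: leq_trans (size_polyD _ _) _; rewrite geq_max; apply/andP; split.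
  apply: leq_trans (size_polyD _ _) _; rewrite size_polyN geq_max; apply/andP; split.
    by apply: leq_trans (size_mul_leq (eq_leq (size_nodal z)) u2) _; lia.
  by apply: leq_trans (size_mul_leq B1 u1) _; lia.
by apply: leq_trans (size_mul_leq H1 uk) _; lia.
Qed.

End Residues.

(** * Residues at a single point and their linear relations *)

Section LocalResidues.
Variables (K : numFieldType) (n : nat) (z : 'I_n -> K) (m : 'I_n -> nat) (h : 'I_n -> K).
Variable l : nat.
Local Notation M := (\sum_(s < n) m s)%N.
Local Notation D := (oper z m h).
Local Notation y i := ('X - (z i)%:P).
Local Notation S := (sing z m).
Hypothesis z_inj : injective z.
Hypothesis dominant : (2 * l <= M)%N.
Hypothesis h_sum : \sum_(s < n) h s = 0.
Hypothesis zh_sum : \sum_(s < n) z s * h s = l%:R * (M%:R + 1 - l%:R).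
Hypothesis n_gt0 : (0 < n)%N.

Variable b : 'I_n -> {poly K}.
Hypothesis Db : forall i, D (b i) = 0.
Hypothesis bz : forall i, (b i).[z i] = 1.

(** Chinese remainders: [Q] copies b_i near z_i and is invisible at the other points, so a residue
    at z_i alone can be written as a total residue. *)
Lemma exists_local_solution i : exists Q : {poly K}, y i ^+ (m i).+1 %| Q - b i /\
  forall j, j != i -> y j ^+ (m j).+1 %| Q.
Proof.
have /Bezout_eq1_coprimepP[[u v] /= uv] := coprime_other_powers m z_inj i.
set w := \prod_(s < n | s != i) _ in uv.
exists (b i * (v * w)); split.
  have -> : b i * (v * w) - b i = - (b i * u) * y i ^+ (m i).+1.
    rewrite -[X in _ - X](mulr1 (b i)) -uv; ring.
  by rewrite dvdp_mull.
move=> j ji; rewrite mulrA dvdp_mull // /w (bigD1 j) //=; exact: dvdp_mulIl.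
Qed.

Definition local_solution i : {poly K} := sval (cid (exists_local_solution i)).
Local Notation Q := local_solution.

Lemma local_solution_self i : y i ^+ (m i).+1 %| Q i - b i.
Proof. by rewrite /local_solution; case: cid => q []. Qed.

Lemma local_solution_other i j : j != i -> y j ^+ (m j).+1 %| Q i.
Proof. by move=> ji; rewrite /local_solution; case: cid => q /= [_]; exact. Qed.

Lemma horner_local_solution i j : (Q i).[z j] = (i == j)%:R.
Proof.
have root_of u k : y k ^+ (m k).+1 %| u -> u.[z k] = 0.
  by move=> H; apply/eqP; rewrite -rootE -dvdp_XsubCl (dvdp_trans _ H) // exprS dvdp_mulIl.
have [<-|ij] := eqVneq i j.
  have /root_of := local_solution_self i; rewrite hornerD hornerN bz => /eqP.
  by rewrite subr_eq0 => /eqP.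
by apply: root_of; apply: local_solution_other; rewrite eq_sym.
Qed.

(** At z_i, [Q i] is the solution b_i modulo an ideal which the operator preserves; at the other
    points it lies in that ideal. *)
Lemma sing_oper_local_solution i : S %| D (Q i).
Proof.
apply: sing_dvdP => // j; have [->|ji] := eqVneq j i; last first.
  by apply: oper_ideal; apply: local_solution_other.
rewrite -[Q i](subrK (b i)) operD Db addr0; apply: oper_ideal.
exact: local_solution_self.
Qed.

(* The residue at [z i] of [p * b i / sing]. *)
Definition local_residue i (p : {poly K}) : K := total_residue z m (p * Q i).
Local Notation rho := local_residue.

Lemma local_residueD i p q : rho i (p + q) = rho i p + rho i q.
Proof. by rewrite /local_residue mulrDl total_residueD. Qed.

Lemma local_residueZ i c p : rho i (c *: p) = c * rho i p.
Proof. by rewrite /local_residue -scalerAl total_residueZ. Qed.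

Lemma local_residue_dvd i p : y i ^+ (m i).+1 %| p -> rho i p = 0.
Proof.
move=> ip; apply: total_residue_dvd; apply: sing_dvdP => // j.
have [->|ji] := eqVneq j i; first by rewrite dvdp_mulr.
by rewrite dvdp_mull // local_solution_other.
Qed.

Lemma local_residue_oper i q : rho i (D q) = 0.
Proof.
rewrite /local_residue oper_adjoint total_residue_dvd // dvdp_mull //.
exact: sing_oper_local_solution.
Qed.

(** A solution is determined modulo (x - z_i)^(m_i + 1) by its value at z_i, so f and \sum_i f(z_i)
    Q_i agree modulo S. *)
Lemma sum_local_residue (f p : {poly K}) : D f = 0 ->
  \sum_(i < n) f.[z i] * rho i p = total_residue z m (p * f).
Proof.
move=> Df; rewrite (@total_residue_eq _ _ z m _ (\sum_(i < n) f.[z i] *: (p * Q i))).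
  by rewrite total_residue_sum; apply: eq_bigr => i _; rewrite total_residueZ.
have -> : p * f - \sum_(i < n) f.[z i] *: (p * Q i) = p * (f - \sum_(i < n) f.[z i] *: Q i).
  rewrite mulrBr mulr_sumr; congr (_ - _); apply: eq_bigr => i _; exact: scalerAr.
apply: dvdp_mull; apply: sing_dvdP => // i; rewrite (bigD1 i) //= opprD addrA.
apply: dvdp_sub; last first.
  elim/big_rec: _ => [|j q ji IH]; first exact: dvdp0.
  by rewrite dvdp_addr // -mul_polyC dvdp_mull // local_solution_other // eq_sym.
have -> : f - f.[z i] *: Q i = (f - f.[z i] *: b i) - f.[z i] *: (Q i - b i).
  by rewrite scalerBr opprB addrA subrK.
apply: dvdp_sub; last by rewrite -mul_polyC dvdp_mull // local_solution_self.
apply: (solution_dvd (h := h) z_inj); first by rewrite -scaleNr operD operZ Df Db scaler0 addr0.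
by rewrite hornerD hornerN hornerZ bz mulr1 subrr.
Qed.

Lemma local_residue_relation (f p : {poly K}) : D f = 0 ->
  (size p + size f <= M + n)%N -> \sum_(i < n) f.[z i] * rho i p = 0.
Proof.
move=> Df pf; rewrite sum_local_residue // total_residue_small.
  by rewrite nth_default // (leq_trans (size_polyMleq _ _)) // -!subn1 leq_sub2r.
by rewrite (leq_trans (size_polyMleq _ _)) // (leq_trans _ pf) // leq_pred.
Qed.

(** The remainder q of \sum c_i Q_i modulo S is orthogonal to all p of degree < l + n - 1, which
    bounds its degree by M - l. Then D q is a multiple of S of degree less than that of S, so q is a
    solution too small to be anything but a multiple of f. *)
Lemma local_residue_independent (f : {poly K}) (c : 'I_n -> K) :
  D f = 0 -> size f = l.+1 ->
  (forall p : {poly K}, (size p < l + n)%N -> \sum_(i < n) c i * rho i p = 0) ->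
  exists e, forall i, c i = e * f.[z i].
Proof.
move=> Df sf Hc; pose q0 := \sum_(i < n) c i *: Q i; pose q := q0 %% S.
have resq (p : {poly K}) : (size p < l + n)%N -> total_residue z m (p * q) = 0.
  move=> /Hc {1}<-; rewrite /total_residue modp_mul -/(total_residue z m (p * q0)).
  rewrite mulr_sumr total_residue_sum; apply: eq_bigr => i _.
  by rewrite -scalerAr total_residueZ.
have sq : (size q <= (M - l).+1)%N.
  rewrite leqNgt; apply/negP => lq.
  have sq : (size q <= M + n)%N.
    by rewrite -ltnS -(size_sing z m) ltn_modp monic_neq0 // sing_monic.
  (* This power moves the leading coefficient of [q] to the place that the total residue reads. *)
  have := resq 'X^(M + n - size q); rewrite size_polyXn => /(_ _) H.
  have q0' : q != 0 by rewrite -size_poly_gt0; lia.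
  have : lead_coef q = 0.
    rewrite -H; last by lia.
    rewrite total_residue_small; last first.
      by rewrite mulrC size_mulXn // subnK.
    rewrite coefXnM ifN; last by rewrite -leqNgt; lia.
    by rewrite lead_coefE; congr (_`_ _); lia.
  by move/eqP; rewrite lead_coef_eq0 (negbTE q0').
have Dq : D q = 0.
  apply/eqP; apply: contraT => Dq0.
  have : S %| D q.
    have -> : q = q0 - q0 %/ S * S by rewrite [in X in X - _](divp_eq q0 S) addrC addKr.
    rewrite -scaleN1r operD operZ dvdp_add // -?mul_polyC ?dvdp_mull //.
      rewrite oper_sum; elim/big_rec: _ => [|i u _ IH]; first exact: dvdp0.
      by rewrite dvdp_addr // operZ -mul_polyC dvdp_mull // sing_oper_local_solution.
    by apply: oper_sing => //; rewrite dvdp_mull.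
  move/(dvdp_leq Dq0); rewrite size_sing => /leq_trans /(_ (size_oper z m h n_gt0 sq)).
  by rewrite addnC ltn_add2l ltnNge leq_subr.
have [e qE] := solution_unique dominant h_sum zh_sum n_gt0 Df sf Dq sq.
exists e => i; rewrite -hornerZ -qE horner_mod ?root_sing // horner_sum (bigD1 i) //=.
rewrite hornerZ horner_local_solution eqxx mulr1 big1 ?addr0 // => j ji.
by rewrite hornerZ horner_local_solution (negbTE ji) mulr0.
Qed.

End LocalResidues.

(** * Separation of variables *)

Section DetExpansion.
Variables (R : comNzRingType) (n : nat).

Lemma det_sum_expansion N (w : 'I_n -> 'I_N -> R) (c : 'I_n -> 'I_n -> 'I_N -> R) :
  \det (\matrix_(i, j) \sum_k w i k * c i j k) =
  \sum_(x : {ffun 'I_n -> 'I_N}) (\prod_i w i (x i)) * \det (\matrix_(i, j) c i j (x i)).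
Proof.
rewrite /determinant.
under [RHS]eq_bigr do rewrite mulr_sumr.
rewrite exchange_big /=; apply: eq_bigr => s _.
under eq_bigr do rewrite mxE.
rewrite bigA_distr_bigA /= mulr_sumr; apply: eq_bigr => x _.
rewrite big_split /= mulrCA; congr (_ * (_ * _)); apply: eq_bigr => i _.
by rewrite mxE.
Qed.

Lemma det_scale_rows (d : 'I_n -> R) (C : 'I_n -> 'I_n -> R) :
  \det (\matrix_(i, j) (d i * C i j)) = (\prod_i d i) * \det (\matrix_(i, j) C i j).
Proof.
rewrite /determinant mulr_sumr; apply: eq_bigr => s _.
rewrite mulrCA -big_split; congr (_ * _); apply: eq_bigr => i _; by rewrite !mxE.
Qed.

(** Cramer's rule without division, valid also for singular matrices: other columns put in place of
    column s give off-diagonal entries of the adjugate times the matrix, which are zero. *)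
Lemma cramer (C : 'I_n -> 'I_n -> R) (e : 'I_n -> R) s :
  \det (\matrix_(i, j) (if j == s then \sum_r C i r * e r else C i j)) =
  \det (\matrix_(i, j) C i j) * e s.
Proof.
set C1 := \matrix_(i, j) (if _ then _ else _); set C0 := \matrix_(i, j) C i j.
have cof i : cofactor C1 i s = cofactor C0 i s.
  congr (_ * \det _); apply/matrixP => a b; rewrite !mxE.
  by rewrite eq_sym (negbTE (neq_lift _ _)).
rewrite (expand_det_col _ s).
under eq_bigr do rewrite cof mxE eqxx mulr_suml.
rewrite exchange_big /= (bigD1 s) //= [X in _ + X]big1 ?addr0.
  rewrite (expand_det_col C0 s) mulr_suml; apply: eq_bigr => i _; rewrite !mxE; ring.
move=> r rs; have: (\adj C0 *m C0) s r = 0 by rewrite mul_adj_mx mxE eq_sym (negbTE rs).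
rewrite mxE => H; transitivity ((\sum_i (\adj C0) s i * C0 i r) * e r); last by rewrite H mul0r.
by rewrite mulr_suml; apply: eq_bigr => i _; rewrite !mxE; ring.
Qed.

End DetExpansion.

(** Lagrange interpolation makes the functional a quadrature rule with nodes chosen in advance. *)
Lemma functional_nodes (K : fieldType) N (x : 'I_N -> K) (rho : {poly K} -> K) :
  injective x -> (forall p q, rho (p + q) = rho p + rho q) ->
  (forall c p, rho (c *: p) = c * rho p) ->
  exists w : 'I_N -> K, forall p : {poly K}, (size p <= N)%N -> rho p = \sum_k w k * p.[x k].
Proof.
move=> x_inj rhoD rhoZ.
exists (fun k => rho (nodal_at x k) / (nodal_at x k).[x k]) => p pN.
have rho0 : rho 0 = 0 by rewrite -(scale0r 0) rhoZ mul0r.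
rewrite {1}(interpolation x_inj pN) (big_morph rho rhoD rho0).
by apply: eq_bigr => k _; rewrite rhoZ mulrC -mulrA [_^-1 * _]mulrC.
Qed.

(* Sklyanin's separated variables: [t] runs over the roots of [\sum_s mu s / (x - z s)]. *)
Section SeparatedVariables.
Variables (K : numFieldType) (n : nat) (z : 'I_n -> K) (m kap : 'I_n -> nat) (h : 'I_n -> K).
Hypothesis z_inj : injective z.
Local Notation A := (nodal z).
Local Notation D := (oper z m h).

Definition powers : {poly K} := \prod_(s < n) ('X - (z s)%:P) ^+ kap s.

Lemma powers_monic : powers \is monic.
Proof. by apply: monic_prod => s _; rewrite monic_exp // monicXsubC. Qed.

Lemma size_powers : size powers = (\sum_(s < n) kap s).+1.
Proof.
rewrite size_prod => [|s _]; last by rewrite expf_neq0 // polyXsubC_eq0.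
under eq_bigr do rewrite size_exp_XsubC.
rewrite (eq_bigr (fun s => kap s + 1)%N) => [|s _]; last by rewrite addn1.
by rewrite big_split /= sum_nat_const card_ord; lia.
Qed.

Lemma powers_deriv (t : K) : (forall s, t != z s) ->
  powers^`().[t] = (\sum_(s < n) (kap s)%:R / (t - z s)) * powers.[t].
Proof.
move=> tz; have A0 : A.[t] != 0.
  by rewrite horner_prod prodf_seq_neq0; apply/allP => s _; rewrite hornerXsubC subr_eq0 tz.
have /(congr1 (fun p : {poly K} => p.[t])) := nodal_dlog z kap.
by rewrite !hornerM (horner_sum_nodal_at _ tz) -mulrA => /(mulfI A0).
Qed.

Lemma powers_deriv2 (t : K) : (forall s, t != z s) ->
  powers^`()^`().[t] = ((\sum_(s < n) (kap s)%:R / (t - z s)) ^+ 2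
     - \sum_(s < n) (kap s)%:R / (t - z s) ^+ 2) * powers.[t].
Proof.
move=> tz; have A0 : A.[t] != 0.
  by rewrite horner_prod prodf_seq_neq0; apply/allP => s _; rewrite hornerXsubC subr_eq0 tz.
have dA s : (nodal_at z s)^`().[t] = A^`().[t] / (t - z s) - A.[t] / (t - z s) ^+ 2.
  have ts : t - z s != 0 by rewrite subr_eq0.
  rewrite (nodalE z s) derivM derivXsubC mul1r !(hornerXsubC, hornerD, hornerM).
  by field.
have /(congr1 (fun p : {poly K} => p^`().[t])) := nodal_dlog z kap.
rewrite -/powers !derivM !(hornerD, hornerM) (horner_sum_nodal_at _ tz) powers_deriv //.
rewrite linear_sum /= horner_sum.
have -> : \sum_(i < n) ((kap i)%:R *: nodal_at z i)^`().[t] =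
    A^`().[t] * (\sum_(s < n) (kap s)%:R / (t - z s))
    - A.[t] * (\sum_(s < n) (kap s)%:R / (t - z s) ^+ 2).
  rewrite !mulr_sumr -sumrB; apply: eq_bigr => s _; rewrite derivZ hornerZ dA; ring.
move: (\sum_(s < n) _) (\sum_(s < n) _) => k2 k1 H; apply: (mulfI A0).
apply: (addrI (A^`().[t] * (k1 * powers.[t]))); rewrite H; ring.
Qed.

Variable mu : 'I_n -> K.
Hypothesis mu_neq0 : forall s, mu s != 0.

(* The action of [H_s] on the monomial [\prod_s mu s ^+ kap s], divided by that monomial. *)
Definition gaudin_symbol (s : 'I_n) : K :=
  \sum_(r < n | r != s) (z s - z r)^-1 *
    ((m s * kap r)%:R + (m r * kap s)%:R - 2 * (kap s * kap r)%:R
     - (kap s)%:R * ((m s)%:R + 1 - (kap s)%:R) * (mu r / mu s)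
     - (kap r)%:R * ((m r)%:R + 1 - (kap r)%:R) * (mu s / mu r)).

Let X s r : K := (m s * kap r)%:R + (m r * kap s)%:R - 2 * (kap s * kap r)%:R
     - (kap s)%:R * ((m s)%:R + 1 - (kap s)%:R) * (mu r / mu s)
     - (kap r)%:R * ((m r)%:R + 1 - (kap r)%:R) * (mu s / mu r).

Let XC s r : X s r = X r s. Proof. rewrite /X; ring. Qed.

Lemma sum_pairs_sym (F : 'I_n -> 'I_n -> K) :
  \sum_(s < n) \sum_(r < n | r != s) F s r = \sum_(s < n) \sum_(r < n | r != s) F r s.
Proof.
rewrite (exchange_big_dep xpredT) //=; apply: eq_bigr => s _.
by apply: eq_bigl => r; rewrite eq_sym.
Qed.

Lemma sum_pairs_eq (F G : 'I_n -> 'I_n -> K) :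
  (forall s r, r != s -> F s r + F r s = G s r + G r s) ->
  \sum_(s < n) \sum_(r < n | r != s) F s r = \sum_(s < n) \sum_(r < n | r != s) G s r.
Proof.
move=> FG; have two0 : 2 != 0 :> K by rewrite pnatr_eq0.
apply: (mulfI two0); rewrite !mulr_natl !mulr2n {2}sum_pairs_sym [X in _ = _ + X]sum_pairs_sym.
rewrite -!big_split; apply: eq_bigr => s _; rewrite -!big_split; apply: eq_bigr => r rs.
exact: FG.
Qed.

Lemma sum_gaudin_symbol : \sum_(s < n) gaudin_symbol s = 0.
Proof.
rewrite /gaudin_symbol (sum_pairs_eq (G := fun _ _ => 0)) => [|s r rs].
  by apply: big1 => s _; apply: big1.
by rewrite -/(X s r) -/(X r s) XC -mulrDl -[z r - z s]opprB invrN subrr mul0r addr0.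
Qed.

(** From (z_s - z_r)^-1 (1/(t - z_s) - 1/(t - z_r)) = 1/((t - z_s)(t - z_r)) and the symmetry of
    [X], the denominators z_s - z_r disappear. The equation for t then eliminates the ratios of the
    [mu], and logarithmic derivatives of [powers] remain. *)
Lemma separated_equation (t : K) : (forall s, t != z s) ->
  \sum_(s < n) mu s / (t - z s) = 0 ->
  A.[t] * powers.[t] * \sum_(s < n) (gaudin_symbol s - h s) / (t - z s) = - (D powers).[t].
Proof.
move=> tz mut; pose tau s := (t - z s)^-1.
have tz0 s : t - z s != 0 by rewrite subr_eq0.
(* One half of [X]: X s r = Y s r + Y r s. The sum of [Y] over r involves the [mu r] linearly, so
   the equation for t applies to it. *)
pose Y s r : K := (m s * kap r)%:R - (kap s * kap r)%:R
  - (kap s)%:R * ((m s)%:R + 1 - (kap s)%:R) * (mu r / mu s).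
pose k1 := \sum_(s < n) (kap s)%:R / (t - z s).
pose k2 := \sum_(s < n) (kap s)%:R / (t - z s) ^+ 2.
pose m1 := \sum_(s < n) (m s)%:R / (t - z s).
have symb : \sum_(s < n) gaudin_symbol s / (t - z s) = (m1 - k1) * k1 + k2.
  transitivity (\sum_(s < n) \sum_(r < n | r != s) Y s r * (tau s * tau r)).
    under eq_bigr do rewrite -/(tau _) /gaudin_symbol mulr_suml.
    apply: (sum_pairs_eq (F := fun s r => (z s - z r)^-1 * X s r * tau s)) => s r rs.
    have zsr : z s - z r != 0 by rewrite subr_eq0; apply: contra rs => /eqP/z_inj ->.
    have zrs : z r - z s != 0 by rewrite subr_eq0; apply: contra rs => /eqP/z_inj ->.
    have -> : (z s - z r)^-1 * X s r * tau s + (z r - z s)^-1 * X r s * tau r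
        = X s r * (tau s * tau r).
      by rewrite (XC r s) /tau; field; rewrite !tz0 zrs zsr.
    by rewrite /X /Y !natrM; ring.
  have Ys s : \sum_(r < n | r != s) Y s r * (tau s * tau r) =
      ((m s)%:R - (kap s)%:R) * tau s * k1 + (kap s)%:R * tau s ^+ 2.
    have -> : \sum_(r < n | r != s) Y s r * (tau s * tau r) =
        ((m s)%:R - (kap s)%:R) * tau s * (\sum_(r < n | r != s) (kap r)%:R * tau r)
        - (kap s)%:R * ((m s)%:R + 1 - (kap s)%:R) * tau s / mu s
          * (\sum_(r < n | r != s) mu r * tau r).
      rewrite !mulr_sumr -sumrB; apply: eq_bigr => r _; rewrite /Y !natrM; ring.
    have -> : \sum_(r < n | r != s) (kap r)%:R * tau r = k1 - (kap s)%:R * tau s.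
      by rewrite /k1 [X in _ = X - _](bigD1 s) //= [X in _ = X - _]addrC addrK.
    have -> : \sum_(r < n | r != s) mu r * tau r = - (mu s * tau s).
      by move: mut; rewrite (bigD1 s) //= => /eqP; rewrite addrC addr_eq0 => /eqP.
    by field; rewrite mu_neq0.
  under eq_bigr do rewrite Ys.
  rewrite big_split /= -mulr_suml; congr (_ * _ + _).
    by rewrite /m1 /k1 -sumrB; apply: eq_bigr => s _; rewrite mulrBl.
  by apply: eq_bigr => s _; rewrite exprVn.
under eq_bigr do rewrite mulrBl.
rewrite sumrB symb /oper !(hornerD, hornerN, hornerM) powers_deriv // powers_deriv2 //.
rewrite !(horner_sum_nodal_at _ tz) -/k1 -/k2 -/m1; ring.
Qed.

End SeparatedVariables.

Definition raise n (s : 'I_n) (kap : 'I_n -> nat) : 'I_n -> nat :=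
  fun r => (kap r + (r == s))%N.

(** For [kap s = 0] the truncated subtraction removes nothing and the total grows by one; in the
    identities for the Hamiltonians such values carry the coefficient [kap s]. *)
Definition transfer n (s r : 'I_n) (kap : 'I_n -> nat) : 'I_n -> nat :=
  fun t => (kap t - (t == s) + (t == r))%N.

Lemma sum_raise n (s : 'I_n) kap : (\sum_(r < n) raise s kap r = (\sum_(r < n) kap r).+1)%N.
Proof.
rewrite big_split -addn1; congr (_ + _)%N.
by rewrite (bigD1 s) // eqxx big1 // => r /negbTE ->.
Qed.

Lemma prod_raise (K : comNzRingType) n (s : 'I_n) kap (mu : 'I_n -> K) :
  \prod_(r < n) mu r ^+ raise s kap r = (\prod_(r < n) mu r ^+ kap r) * mu s.
Proof.
under eq_bigr do rewrite exprD.
rewrite big_split; congr (_ * _); rewrite (bigD1 s) // eqxx big1 /=.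
  by rewrite mulr1 expr1.
by move=> r /negbTE ->.
Qed.

Lemma raise_transfer n (s r : 'I_n) kap t : (0 < kap s)%N ->
  raise s (transfer s r kap) t = raise r kap t.
Proof.
rewrite /raise /transfer => ks; have [->|_] := eqVneq t s; last by rewrite subn0 addn0.
by rewrite addnAC subnK.
Qed.

Lemma sum_transfer n (s r : 'I_n) kap : (0 < kap s)%N ->
  (\sum_(t < n) transfer s r kap t = \sum_(t < n) kap t)%N.
Proof.
move=> ks; apply: succn_inj; rewrite -(sum_raise s) -(sum_raise r).
by apply: eq_bigr => t _; apply: raise_transfer.
Qed.

Lemma prod_transfer (K : comNzRingType) n (s r : 'I_n) kap (mu : 'I_n -> K) : (0 < kap s)%N ->
  (\prod_(t < n) mu t ^+ transfer s r kap t) * mu s = (\prod_(t < n) mu t ^+ kap t) * mu r.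
Proof.
by move=> ks; rewrite -!prod_raise; apply: eq_bigr => t _; rewrite raise_transfer.
Qed.

Section SeparatedCoordinates.
Variables (K : numFieldType) (n : nat) (z t : 'I_n -> K) (r0 : 'I_n).
Hypothesis z_inj : injective z.
Hypothesis tz : forall i s, t i != z s.
Local Notation a s := (nodal_at z s).[z s].

(* The monomials in [sep_coord] are products of functions of one variable [t i] each,
   see [prod_powers]. *)
Definition sep_coord (s : 'I_n) : K := (nodal_at t r0).[z s] / a s.

Lemma sep_coord_neq0 s : sep_coord s != 0.
Proof.
apply: mulf_neq0; last by rewrite invr_eq0 nodal_at_neq0.
rewrite horner_prod prodf_seq_neq0.
by apply/allP => i _; apply/implyP => _; rewrite hornerXsubC subr_eq0 eq_sym tz.
Qed.

Lemma sum_sep_coord : \sum_(s < n) sep_coord s = 1.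
Proof. by rewrite interpolation_top ?size_nodal_at ?coef_nodal_at_top. Qed.

(** The sum is the partial fraction expansion, at x = t_i, of the quotient of the product of the x -
    t_j, j <> r0, by [nodal z]. *)
Lemma sep_coord_eq i : i != r0 -> \sum_(s < n) sep_coord s / (t i - z s) = 0.
Proof.
move=> ir; have sN : (size (nodal_at t r0) <= n)%N by rewrite size_nodal_at.
have := congr1 (fun p : {poly K} => p.[t i]) (interpolation z_inj sN).
rewrite /= nodal_at_eq0 // (horner_sum_nodal_at _ (tz i)) => /esym/eqP.
rewrite mulf_eq0 => /orP[|/eqP //].
rewrite horner_prod => /eqP H0; have : \prod_(s < n) (t i - z s) != 0.
  by rewrite prodf_seq_neq0; apply/allP => s _; rewrite subr_eq0 tz.
by rewrite -[X in X != _](eq_bigr _ (fun s _ => hornerXsubC (z s) (t i))) H0 eqxx.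
Qed.

Lemma prod_powers kap : \prod_(i < n | i != r0) (powers z kap).[t i] =
  \prod_(s < n) ((-1) ^+ n.-1 * a s * sep_coord s) ^+ kap s.
Proof.
under eq_bigr do rewrite horner_prod.
rewrite exchange_big /=; apply: eq_bigr => s _.
under eq_bigr do rewrite horner_exp hornerXsubC.
rewrite prodrXl; congr (_ ^+ _).
have -> : (-1) ^+ n.-1 * a s * sep_coord s = (-1) ^+ n.-1 * (nodal_at t r0).[z s].
  by rewrite /sep_coord; field; exact: nodal_at_neq0.
rewrite horner_prod; under [in RHS]eq_bigr do rewrite hornerXsubC -opprB.
rewrite (eq_bigl (mem (predC1 r0))) // [X in _ = _ * X](eq_bigl (mem (predC1 r0))) //.
by rewrite prodrN cardC1 card_ord mulrA -exprD addnn -signr_odd odd_double mul1r.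
Qed.

End SeparatedCoordinates.

(** * The multiple residue as a determinant and as a finite sum *)

Section MultiResidue.
Variables (K : numFieldType) (n : nat) (z : 'I_n -> K) (m : 'I_n -> nat) (h : 'I_n -> K).
Variables (l : nat) (r0 : 'I_n) (rho : 'I_n -> {poly K} -> K).
Local Notation A := (nodal z).
Local Notation D := (oper z m h).
Local Notation a s := (nodal_at z s).[z s].
Hypothesis z_inj : injective z.
Hypothesis h_sum : \sum_(s < n) h s = 0.
Hypothesis rhoD : forall i p q, rho i (p + q) = rho i p + rho i q.
Hypothesis rhoZ : forall i c p, rho i (c *: p) = c * rho i p.
Hypothesis rho_oper : forall i q, rho i (D q) = 0.

Definition residue_mx (kap : 'I_n -> nat) : 'M[K]_n :=
  \matrix_(i, s) (if i == r0 then 1 else rho i (powers z kap * nodal_at z s)).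

(* Up to a constant, the iterated residue of the product of the monomial [sep_coord ^ kap] with
   [\prod_(i != r0) b i (t i) / sing (t i)] and the Vandermonde determinant of the [t i]. *)
Definition multi_residue (kap : 'I_n -> nat) : K :=
  (\prod_(s < n) ((-1) ^+ n.-1 / a s) ^+ kap s) * \det (residue_mx kap).

Lemma exists_nodes N : (0 < N)%N -> exists (w : 'I_n -> 'I_N -> K) (x : 'I_N -> K),
  [/\ forall k s, x k != z s, \sum_k w r0 k = 1 &
    forall i (p : {poly K}), i != r0 -> (size p <= N)%N -> rho i p = \sum_k w i k * p.[x k]].
Proof.
move=> N0; have S0 : 0 <= \sum_(s < n) `|z s| by apply: sumr_ge0.
pose x (k : 'I_N) : K := k.+1%:R + \sum_(s < n) `|z s|.
have xz k s : x k != z s.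
  apply/eqP => /(congr1 Num.norm); rewrite ger0_norm ?addr_ge0 //.
  move/eqP; rewrite gt_eqF // /x (bigD1 s) //= addrCA ltrDl ltr_pwDl ?ltr0n //.
  by apply: sumr_ge0.
have x_inj : injective x.
  by move=> k j /addIr/eqP; rewrite eqr_nat eqSS => /eqP/val_inj.
have H i : exists w : 'I_N -> K,
    forall p : {poly K}, (size p <= N)%N -> rho i p = \sum_k w k * p.[x k].
  exact: functional_nodes (rhoD i) (rhoZ i).
have [w Hw] := choice H.
(* The omitted variable gets unit mass at one node, so that the row of ones expands like the
   others. *)
exists (fun i k => if i == r0 then (k == Ordinal N0)%:R else w i k), x; split => //.
- under eq_bigr do rewrite eqxx.
  rewrite (bigD1 (Ordinal N0)) // eqxx big1 /=; first by rewrite addr0.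
  by move=> k /negbTE ->.
by move=> i p /negbTE ->; apply: Hw.
Qed.

Section Nodes.
Variables (N : nat) (w : 'I_n -> 'I_N -> K) (x : 'I_N -> K).
Hypothesis xz : forall k s, x k != z s.
Hypothesis sum_w0 : \sum_k w r0 k = 1.
Hypothesis rhoE : forall i (p : {poly K}), i != r0 -> (size p <= N)%N ->
  rho i p = \sum_k w i k * p.[x k].
Local Notation point X := (fun i => x (fun_of_fin X i)).

Lemma det_rho_expansion (P : 'I_n -> {poly K}) (c : 'I_n -> K) :
  (forall j, (size (P j) <= N)%N) ->
  \det (\matrix_(i, j) (if i == r0 then c j else rho i (P j))) =
  \sum_(X : {ffun 'I_n -> 'I_N}) (\prod_i w i (X i)) *
     \det (\matrix_(i, j) (if i == r0 then c j else (P j).[x (X i)])).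
Proof.
move=> sP; rewrite -(det_sum_expansion w (fun i j k => if i == r0 then c j else (P j).[x k])).
congr (\det _); apply/matrixP => i j; rewrite !mxE.
have [->|ir] := eqVneq i r0; first by rewrite -mulr_suml sum_w0 mul1r.
exact: rhoE.
Qed.

Definition cauchy (X : {ffun 'I_n -> 'I_N}) (i s : 'I_n) : K :=
  if i == r0 then 1 else (x (X i) - z s)^-1.

Definition node_weight (X : {ffun 'I_n -> 'I_N}) : K :=
  (\prod_i w i (X i)) * (\prod_(i < n | i != r0) A.[x (X i)])
    * \det (\matrix_(i, s) cauchy X i s).

Lemma prod_scale_powers (X : {ffun 'I_n -> 'I_N}) kap :
  (\prod_(s < n) ((-1) ^+ n.-1 / a s) ^+ kap s) *
    \prod_(i < n | i != r0) (powers z kap).[x (X i)] =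
  \prod_(s < n) sep_coord z (point X) r0 s ^+ kap s.
Proof.
rewrite (@prod_powers _ _ z (point X) r0 z_inj) -big_split; apply: eq_bigr => s _ /=.
rewrite -exprMn; congr (_ ^+ _).
have e2 : (-1) ^+ n.-1 * (-1) ^+ n.-1 = 1 :> K.
  by rewrite -exprD addnn -signr_odd odd_double.
have E (e b c : K) : b != 0 -> e * e = 1 -> e / b * (e * b * c) = c.
  by move=> b0 ee; rewrite [LHS](_ : _ = e * e * c); [rewrite ee mul1r | field].
by apply: E; first exact: nodal_at_neq0.
Qed.

(** The bound makes the quadrature exact on the matrix entries. As [node_weight] does not involve
    [kap], linear relations between multiple residues follow from pointwise relations between
    monomials. *)
Lemma multi_residue_sum kap : (\sum_(s < n) kap s + n <= N)%N ->
  multi_residue kap =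
    \sum_X node_weight X * \prod_(s < n) sep_coord z (point X) r0 s ^+ kap s.
Proof.
move=> kN; rewrite /multi_residue /residue_mx det_rho_expansion => [|s]; last first.
  apply: leq_trans kN; rewrite size_monicM ?powers_monic ?monic_neq0 ?nodal_at_monic //.
  by rewrite size_powers size_nodal_at.
rewrite mulr_sumr; apply: eq_bigr => X _.
rewrite -prod_scale_powers /node_weight.
pose d i := if i == r0 then 1 else (powers z kap).[x (X i)] * A.[x (X i)].
have prod_d : \prod_i d i = (\prod_(i < n | i != r0) (powers z kap).[x (X i)]) *
    \prod_(i < n | i != r0) A.[x (X i)].
  rewrite (bigD1 r0) //= {1}/d eqxx mul1r -big_split.
  by apply: eq_bigr => i ir; rewrite /d (negbTE ir).
have -> : (\matrix_(i, j) (if i == r0 then 1 else (powers z kap * nodal_at z j).[x (X i)])) =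
    \matrix_(i, j) (d i * cauchy X i j) :> 'M[K]_n.
  apply/matrixP => i j; rewrite !mxE /d /cauchy.
  by case: eqP => _; rewrite ?mul1r // hornerM horner_nodal_at ?mulrA.
rewrite det_scale_rows prod_d; ring.
Qed.

Lemma multi_residue_raise_nodes kap : (\sum_(s < n) kap s + n < N)%N ->
  \sum_(s < n) multi_residue (raise s kap) = multi_residue kap.
Proof.
move=> kN; under eq_bigr do rewrite multi_residue_sum ?sum_raise //.
rewrite exchange_big multi_residue_sum; last exact: ltnW.
apply: eq_bigr => X _ /=; rewrite -mulr_sumr; congr (_ * _).
rewrite (eq_bigr _ (fun s _ => prod_raise s kap (sep_coord z (point X) r0))).
by rewrite -mulr_sumr sum_sep_coord ?mulr1 // => i s; exact: xz.
Qed.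

(** Column s of the residue matrix is replaced by the residues of -D(powers), with 0 in row r0; this
    column is zero. At each tuple of nodes, [separated_equation] and [sum_gaudin_symbol] write it as
    the combination of the columns with coefficients symbol_r - h_r, and Cramer's rule extracts the
    coefficient of index s. *)
Lemma gaudin_symbol_sum kap s : (\sum_(r < n) kap r + n <= N)%N ->
  \sum_X node_weight X * (\prod_(r < n) sep_coord z (point X) r0 r ^+ kap r) *
    (gaudin_symbol z m kap (sep_coord z (point X) r0) s - h s) = 0.
Proof.
move=> kN; have n0 : (0 < n)%N by apply: leq_ltn_trans (ltn_ord r0).
transitivity ((\prod_(r < n) ((-1) ^+ n.-1 / a r) ^+ kap r) *
  \det (\matrix_(i, j) (if i == r0 then (if j == s then 0 else 1)
   else rho i (if j == s then - D (powers z kap) else powers z kap * nodal_at z j)))); last first.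
  rewrite [X in _ * X](_ : _ = 0) ?mulr0 // (expand_det_col _ s) big1 // => i _; rewrite mxE eqxx.
  by have [_|ir] := eqVneq i r0; rewrite ?mul0r // -scaleN1r rhoZ rho_oper mulr0 mul0r.
rewrite det_rho_expansion => [|j]; last first.
  apply: leq_trans kN; have [_|_] := eqVneq j s.
    by rewrite size_polyN addnC; apply: size_oper; rewrite ?size_powers.
  by rewrite size_monicM ?powers_monic ?monic_neq0 ?nodal_at_monic // size_powers size_nodal_at.
rewrite mulr_sumr; apply: eq_bigr => X _; pose mu := sep_coord z (point X) r0.
have pz i r : point X i != z r by exact: xz.
have mu0 r : mu r != 0 by apply: sep_coord_neq0.
rewrite -prod_scale_powers -/mu /node_weight.
pose d i := if i == r0 then 1 else (powers z kap).[x (X i)] * A.[x (X i)].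
have prod_d : \prod_i d i = (\prod_(i < n | i != r0) (powers z kap).[x (X i)]) *
    \prod_(i < n | i != r0) A.[x (X i)].
  rewrite (bigD1 r0) //= {1}/d eqxx mul1r -big_split.
  by apply: eq_bigr => i ir; rewrite /d (negbTE ir).
pose e r := gaudin_symbol z m kap mu r - h r.
set C := \prod_(r < n) (_ / _) ^+ _.
have -> : (\matrix_(i, j) (if i == r0 then if j == s then 0 else 1
     else (if j == s then - D (powers z kap) else powers z kap * nodal_at z j).[x (X i)])) =
    \matrix_(i, j) (d i * (if j == s then \sum_r cauchy X i r * e r else cauchy X i j)) :> 'M[K]_n.
  apply/matrixP => i j; rewrite !mxE /d /cauchy.
  have [_|ir] := eqVneq i r0; have [_|_] := eqVneq j s; rewrite ?mul1r //.
  - under eq_bigr do rewrite mul1r.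
    by rewrite /e sumrB sum_gaudin_symbol // h_sum subr0.
  - rewrite hornerN -(@separated_equation _ _ z m kap h z_inj mu mu0 _ (pz i)); last exact: sep_coord_eq.
    rewrite [A.[_] * _]mulrC; congr (_ * _).
    by apply: eq_bigr => r _; rewrite mulrC.
  - by rewrite hornerM horner_nodal_at ?mulrA.
rewrite det_scale_rows cramer -/(e s) prod_d; ring.
Qed.

Lemma multi_residue_gaudin_nodes kap s : (\sum_(r < n) kap r + n <= N)%N ->
  \sum_(r < n | r != s) (z s - z r)^-1 *
    (((m s * kap r)%:R + (m r * kap s)%:R - 2 * (kap s * kap r)%:R) * multi_residue kap
     - (kap s)%:R * ((m s)%:R + 1 - (kap s)%:R) * multi_residue (transfer s r kap)
     - (kap r)%:R * ((m r)%:R + 1 - (kap r)%:R) * multi_residue (transfer r s kap))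
  = h s * multi_residue kap.
Proof.
move=> kN; apply/eqP; rewrite -subr_eq0; apply/eqP.
rewrite -[RHS](gaudin_symbol_sum s kN).
have tr s' r : (kap s')%:R * multi_residue (transfer s' r kap) =
   \sum_X node_weight X * (\prod_(t < n) sep_coord z (point X) r0 t ^+ kap t) *
     ((kap s')%:R * (sep_coord z (point X) r0 r / sep_coord z (point X) r0 s')).
  have [k0|k0] := posnP (kap s').
    by rewrite k0 mul0r big1 // => X _; rewrite mul0r mulr0.
  rewrite multi_residue_sum ?sum_transfer // mulr_sumr; apply: eq_bigr => X _.
  have mu0 : sep_coord z (point X) r0 s' != 0 by apply: sep_coord_neq0 => // i t; exact: xz.
  have := prod_transfer r (sep_coord z (point X) r0) k0.
  move/(canRL (mulfK mu0)) => ->; ring.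
under eq_bigr => r _.
  rewrite [(kap s)%:R * _]mulrC [(kap r)%:R * (_ - _)]mulrC -!mulrA !tr.
  over.
rewrite multi_residue_sum //.
under [RHS]eq_bigr do rewrite /gaudin_symbol mulrBr mulr_sumr.
rewrite [RHS]sumrB [X in _ = X - _]exchange_big /=; congr (_ - _); last first.
  by rewrite mulr_sumr; apply: eq_bigr => X _; rewrite mulrC.
apply: eq_bigr => r _; rewrite !mulr_sumr -!sumrB mulr_sumr; apply: eq_bigr => X _; ring.
Qed.

End Nodes.

Lemma multi_residue_raise kap :
  \sum_(s < n) multi_residue (raise s kap) = multi_residue kap.
Proof.
have [|w [x [xz w0 wE]]] := @exists_nodes (\sum_(s < n) kap s + n).+1; first by [].
exact: (multi_residue_raise_nodes xz w0 wE).
Qed.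

Lemma multi_residue_gaudin kap s :
  \sum_(r < n | r != s) (z s - z r)^-1 *
    (((m s * kap r)%:R + (m r * kap s)%:R - 2 * (kap s * kap r)%:R) * multi_residue kap
     - (kap s)%:R * ((m s)%:R + 1 - (kap s)%:R) * multi_residue (transfer s r kap)
     - (kap r)%:R * ((m r)%:R + 1 - (kap r)%:R) * multi_residue (transfer r s kap))
  = h s * multi_residue kap.
Proof.
have [|w [x [xz w0 wE]]] := @exists_nodes (\sum_(s < n) kap s + n).
  by rewrite addn_gt0 (leq_ltn_trans _ (ltn_ord r0)) ?orbT.
exact: (multi_residue_gaudin_nodes xz w0 wE).
Qed.

End MultiResidue.

(** * Where the multiple residue vanishes and where it does not *)

Section Nonvanishing.
Variables (K : numFieldType) (n : nat) (z : 'I_n -> K) (m : 'I_n -> nat).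
Variables (l : nat) (r0 : 'I_n) (rho : 'I_n -> {poly K} -> K) (c : 'I_n -> K).
Local Notation a s := (nodal_at z s).[z s].
Local Notation y s := ('X - (z s)%:P).
Hypothesis z_inj : injective z.
Hypothesis rhoD : forall i p q, rho i (p + q) = rho i p + rho i q.
Hypothesis rhoZ : forall i c p, rho i (c *: p) = c * rho i p.
Hypothesis rho_dvd : forall i p, y i ^+ (m i).+1 %| p -> rho i p = 0.
Hypothesis rho_rel : forall p : {poly K}, (size p < l + n)%N -> \sum_i c i * rho i p = 0.
Hypothesis rho_indep : forall d : 'I_n -> K,
  (forall p : {poly K}, (size p < l + n)%N -> \sum_i d i * rho i p = 0) ->
  exists e, forall i, d i = e * c i.
Hypothesis c_r0 : c r0 != 0.

Let n_gt0 : (0 < n)%N. Proof. exact: leq_ltn_trans (ltn_ord r0). Qed.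

Lemma powers_raise s kap : powers z (raise s kap) = powers z kap * y s.
Proof. by rewrite /powers prod_raise. Qed.

Lemma size_powers_mul kap (p : {poly K}) N : (size p < N)%N ->
  (size (powers z kap * p)%R < \sum_(s < n) kap s + N)%N.
Proof.
move=> pN; have [->|p0] := eqVneq p 0.
  by rewrite mulr0 size_poly0 addn_gt0 (leq_ltn_trans _ pN) ?orbT.
by rewrite size_monicM ?powers_monic // size_powers addSn /= ltn_add2l.
Qed.

(** The [nodal_at z s] are monic of degree n - 1, so a functional killing smaller degrees takes one
    value on all of them, and a multiple of the row of ones cancels it. *)
Lemma residue_mx_singular kap (d : 'I_n -> K) : d r0 = 0 -> (exists i, d i != 0) ->
  (forall p : {poly K}, (size p < n)%N -> \sum_i d i * rho i (powers z kap * p) = 0) ->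
  \det (residue_mx z r0 rho kap) = 0.
Proof.
move=> d0 [i di] dp; apply/eqP/det0P.
pose tau p := \sum_i d i * rho i (powers z kap * p).
have tauD p q : tau (p + q) = tau p + tau q.
  by rewrite /tau -big_split; apply: eq_bigr => j _; rewrite mulrDr rhoD mulrDr.
have tauN p : tau (- p) = - tau p.
  by rewrite /tau -sumrN; apply: eq_bigr => j _; rewrite mulrN -scaleN1r rhoZ mulN1r mulrN.
have tau_at s : tau (nodal_at z s) = tau (nodal_at z r0).
  apply/eqP; rewrite -subr_eq0 -tauN -tauD; apply/eqP; apply: dp.
  suff : (size (nodal_at z s - nodal_at z r0)%R <= n.-1)%N by rewrite -ltnS prednK.
  apply/leq_sizeP => j; rewrite leq_eqVlt => /orP[/eqP <-|nj].
    by rewrite coefB !coef_nodal_at_top subrr.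
  by rewrite coefB !nth_default ?subrr // size_nodal_at -(prednK n_gt0).
exists (\row_j (if j == r0 then - tau (nodal_at z r0) else d j)).
  apply/eqP => /rowP/(_ i); rewrite !mxE.
  have [ir|_] := eqVneq i r0; first by rewrite ir d0 eqxx in di.
  by move=> di0; rewrite di0 eqxx in di.
apply/rowP => s; rewrite !mxE (bigD1 r0) //= !mxE eqxx mulr1.
rewrite -(tau_at s) /tau (bigD1 r0) //= d0 mul0r add0r addrC; apply/eqP; rewrite subr_eq0.
by apply/eqP; apply: eq_bigr => j jr; rewrite !mxE (negbTE jr).
Qed.

Definition independent_on kap N := forall d : 'I_n -> K, d r0 = 0 ->
  (forall p : {poly K}, (size p < N)%N -> \sum_i d i * rho i (powers z kap * p) = 0) ->
  forall i, d i = 0.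

(** Conversely, a null vector gives a functional constant on the [nodal_at z s]; it kills degrees
    below n - 1, because there the Lagrange coefficients sum to zero. *)
Lemma residue_mx_nonsingular kap : independent_on kap n -> \det (residue_mx z r0 rho kap) != 0.
Proof.
move=> ind; apply/det0P => -[v v0 vB].
pose d i := if i == r0 then 0 else v 0 i.
have dv s : \sum_i d i * rho i (powers z kap * nodal_at z s) = - v 0 r0.
  move/rowP/(_ s): vB; rewrite !mxE (bigD1 r0) //= !mxE eqxx mulr1 => /eqP.
  rewrite addrC addr_eq0 => /eqP <-; rewrite (bigD1 r0) //= {1}/d eqxx mul0r add0r.
  by apply: eq_bigr => i ir; rewrite !mxE /d (negbTE ir).
have d_eq0 : forall i, d i = 0.
  apply: ind => [|p pn]; first by rewrite /d eqxx.
  have rho0 i : rho i 0 = 0 by rewrite -(scale0r 0) rhoZ mul0r.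
  have -> : \sum_i d i * rho i (powers z kap * p) =
      \sum_s (p.[z s] / a s) * \sum_i d i * rho i (powers z kap * nodal_at z s).
    under [RHS]eq_bigr do rewrite mulr_sumr.
    rewrite exchange_big; apply: eq_bigr => i _ /=.
    rewrite {1}(interpolation z_inj (ltnW pn)) mulr_sumr (big_morph _ (rhoD i) (rho0 i)) mulr_sumr.
    by apply: eq_bigr => s _; rewrite -scalerAr rhoZ mulrCA.
  under eq_bigr do rewrite dv.
  rewrite -mulr_suml (interpolation_top z_inj (ltnW pn)) nth_default ?mul0r //.
  by rewrite -ltnS prednK.
have vr : v 0 r0 = 0.
  have := dv r0; rewrite big1 => [/esym/eqP|i _]; last by rewrite d_eq0 mul0r.
  by rewrite oppr_eq0 => /eqP.
case/eqP: v0; apply/rowP => i; rewrite mxE.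
by have := d_eq0 i; rewrite /d; case: eqP => [->|].
Qed.

(** If every s failed, each would give a relation whose functional is a nonzero multiple of
    evaluation at z_s on polynomials of size at most N. These n evaluations are independent since n
    <= N, yet the n coefficient vectors all vanish at r0 and so are dependent. *)
Lemma independent_on_raise kap N : (n <= N)%N -> independent_on kap N.+1 ->
  exists s, independent_on (raise s kap) N.
Proof.
move=> nN ind; apply: contrapT => H.
have Hs s : exists d : 'I_n -> K, [/\ d r0 = 0,
    forall p : {poly K}, (size p < N)%N -> \sum_i d i * rho i (powers z (raise s kap) * p) = 0 &
    exists i, d i != 0].
  apply: contrapT => Hs; apply: H; exists s => d d0 dp i; apply: contrapT => di.
  by apply: Hs; exists d; split => //; exists i; apply/eqP.
have [d Hd] := choice Hs.
have : \det (\matrix_(s, i) d s i) == 0.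
  rewrite (expand_det_col _ r0) big1 // => s _; rewrite mxE.
  by have [-> _ _] := Hd s; rewrite mul0r.
case/det0P => v v0 vd; case/eqP: v0; apply/rowP => s'; rewrite mxE.
pose tau s (p : {poly K}) := \sum_i d s i * rho i (powers z kap * p).
have tauD s p q : tau s (p + q) = tau s p + tau s q.
  by rewrite /tau -big_split; apply: eq_bigr => j _; rewrite mulrDr rhoD mulrDr.
have tauZ s e p : tau s (e *: p) = e * tau s p.
  by rewrite /tau mulr_sumr; apply: eq_bigr => j _; rewrite -scalerAr rhoZ mulrCA.
have tauE s (p : {poly K}) : (size p < N.+1)%N -> tau s p = p.[z s] * tau s 1.
  move=> pN; have : root (p - p.[z s]%:P) (z s) by rewrite rootE !hornerE subrr.
  move=> /factor_theorem[q pq].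
  have -> : tau s p = tau s (p.[z s] *: 1 + q * y s).
    by congr (tau s _); rewrite -pq alg_polyC addrC subrK.
  rewrite tauD tauZ [X in _ + X](_ : _ = 0) ?addr0 //.
  have sq : (size q < N)%N.
    have [->|q0] := eqVneq q 0; first by rewrite size_poly0 (leq_trans n_gt0).
    have : (size (q * y s)%R <= N)%N.
      rewrite -pq (leq_trans (size_polyD _ _)) // size_polyN geq_max -ltnS pN.
      by rewrite (leq_trans (size_polyC_leq1 _)) // (leq_trans n_gt0).
    by rewrite size_Mmonic ?monicXsubC // size_XsubC addn2.
  have [_ Hs0 _] := Hd s; rewrite -[RHS](Hs0 q sq) /tau.
  by apply: eq_bigr => i _; rewrite powers_raise mulrAC mulrA.
have tau1 s : tau s 1 != 0.
  have [d0 _ [i di]] := Hd s; apply: contra di => /eqP t1; apply/eqP; apply: ind => // p pN.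
  by rewrite -/(tau s p) tauE // t1 mulr0.
have sum_tau p : \sum_s v 0 s * tau s p = 0.
  under eq_bigr do rewrite /tau mulr_sumr.
  rewrite exchange_big big1 // => i _ /=.
  move/rowP/(_ i): vd; rewrite !mxE => vdi.
  under eq_bigr do rewrite mulrA.
  rewrite -mulr_suml [X in X * _](_ : _ = 0) ?mul0r // -[RHS]vdi.
  by apply: eq_bigr => s _; rewrite mxE.
have := sum_tau (nodal_at z s'); rewrite (bigD1 s') //= big1 ?addr0 => [|s ss].
  rewrite tauE ?size_nodal_at // => /eqP; rewrite !mulf_eq0 (negbTE (tau1 _)).
  by rewrite (negbTE (nodal_at_neq0 z_inj _)) !orbF => /eqP.
by rewrite tauE ?size_nodal_at // nodal_at_eq0 // mul0r mulr0.
Qed.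

(** Each step trades one degree of the test polynomials for one unit of [kap]. At [kap = 0] every
    relation is a multiple of [c], and c r0 <> 0 makes it zero. *)
Lemma exists_independent_on j : (j <= l)%N ->
  exists kap, (\sum_(s < n) kap s)%N = j /\ independent_on kap (l - j + n).
Proof.
elim: j => [_|j IH jl].
  exists (fun=> 0%N); rewrite big1 //; split => // d d0 dp i.
  have [p pl|e de] := rho_indep (d := d).
    rewrite -[RHS](dp p) ?subn0 //; apply: eq_bigr => j _.
    by rewrite /powers big1 ?mul1r // => s _; rewrite expr0.
  move/eqP: (de r0); rewrite d0 eq_sym mulf_eq0 (negbTE c_r0) orbF => /eqP e0.
  by rewrite de e0 mul0r.
have [kap [kj ind]] := IH (ltnW jl).
have [s Hs] : exists s, independent_on (raise s kap) (l - j.+1 + n).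
  apply: independent_on_raise; first exact: leq_addl.
  by move: ind; rewrite -addSn subnSK.
by exists (raise s kap); rewrite sum_raise kj.
Qed.

Lemma exists_multi_residue_neq0 :
  exists kap, (\sum_(s < n) kap s)%N = l /\ multi_residue z r0 rho kap != 0.
Proof.
have [kap [kl]] := exists_independent_on (leqnn l); rewrite subnn add0n => ind.
exists kap; split => //; apply: mulf_neq0; last exact: residue_mx_nonsingular.
rewrite prodf_seq_neq0; apply/allP => s _; apply/implyP => _.
by rewrite expf_neq0 // mulf_neq0 ?invr_eq0 ?nodal_at_neq0 // signr_eq0.
Qed.

(** For s <> r0 the vanishing of rho_s on multiples of [powers z kap] is itself a relation. For s =
    r0 the relation [c] loses its r0 term; it stays nontrivial, for otherwise the first hypothesis
    gives l <= m_r0 < kap_r0 <= l. *)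
Lemma multi_residue_truncation kap s :
  ((forall i, i != r0 -> c i = 0) -> (l <= m r0)%N) ->
  (\sum_(r < n) kap r)%N = l -> (m s < kap s)%N -> multi_residue z r0 rho kap = 0.
Proof.
move=> Hc kl ms; rewrite /multi_residue.
have ys p : y s ^+ (m s).+1 %| powers z kap * p.
  rewrite dvdp_mulr // /powers (bigD1 s) //= dvdp_mulr // dvdp_exp2l //.
have [sr|sr] := eqVneq s r0; last first.
  rewrite (@residue_mx_singular kap (fun i => (i == s)%:R)) ?mulr0 //.
  - by rewrite eq_sym (negbTE sr).
  - by exists s; rewrite eqxx oner_eq0.
  move=> p _; rewrite big1 // => i _; have [->|_] := eqVneq i s; last by rewrite mul0r.
  by rewrite rho_dvd ?mulr0.
rewrite (@residue_mx_singular kap (fun i => if i == r0 then 0 else c i)) ?mulr0 ?eqxx //.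
  apply: contrapT => H; have : (l <= m r0)%N.
    apply: Hc => i ir; apply: contrapT => ci; apply: H; exists i.
    by rewrite (negbTE ir); apply/eqP.
  rewrite leqNgt -sr (leq_trans ms) // -kl (bigD1 s) //= leq_addr //.
move=> p pn; have pl : (size (powers z kap * p)%R < l + n)%N by rewrite -kl size_powers_mul.
rewrite -[RHS](rho_rel pl) (bigD1 r0) //= eqxx mul0r [RHS](bigD1 r0) //=.
have -> : rho r0 (powers z kap * p) = 0 by rewrite -sr rho_dvd.
rewrite mulr0; congr (_ + _).
by apply: eq_bigr => i ir; rewrite (negbTE ir).
Qed.

(** One degree below l two independent relations [c] and [g] are available, and a combination of
    them has no r0 term. *)
Lemma multi_residue_low kap (g : 'I_n -> K) :
  (forall p : {poly K}, ((size p).+1 < l + n)%N -> \sum_i g i * rho i p = 0) ->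
  ~ (exists e, forall i, g i = e * c i) ->
  (\sum_(r < n) kap r).+1 = l -> multi_residue z r0 rho kap = 0.
Proof.
move=> grel gc kl; rewrite /multi_residue.
rewrite (@residue_mx_singular kap (fun i => g i - g r0 / c r0 * c i)) ?mulr0 //.
- by rewrite divfK // subrr.
- apply: contrapT => H; apply: gc; exists (g r0 / c r0) => i; apply: contrapT => gi.
  by apply: H; exists i; rewrite subr_eq0; apply/eqP.
move=> p pn; have pl : ((size (powers z kap * p)%R).+1 < l + n)%N.
  by rewrite -kl addSn ltnS size_powers_mul.
under eq_bigr do rewrite mulrBl -(mulrA _ (c _)).
by rewrite sumrB grel // -mulr_sumr rho_rel ?mulr0 ?subrr // ltnW.
Qed.

End Nonvanishing.

(** * Irreducible gl_2-modules and their tensor products *)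

Section StandardModule.
Variables (K : numFieldType) (m : nat).

(* [L_(m epsilon_1)] in the basis [e_21^k w / (k! m (m-1) ... (m-k+1))], in which [e_12]
   shifts the index with coefficient 1. *)
Definition std_rep (i j : 'I_2) : 'M[K]_m.+1 :=
  \matrix_(a, b) (
    if i == 0 then (if j == 0 then (a == b)%:R * (m%:R - a%:R) else (a.+1 == b :> nat)%:R)
    else (if j == 0 then (a == b.+1 :> nat)%:R * (a%:R * (m%:R + 1 - a%:R))
          else (a == b)%:R * a%:R)).

Variables (d : nat) (E : 'I_2 -> 'I_2 -> 'M[K]_d) (w : 'cV[K]_d).
Hypothesis E_gl2 : is_gl2_module E.
Hypothesis w_hw : is_highest_weight_vector E m%:R 0 w.

Let wt k : 'cV[K]_d := iter k (mulmx (E 1 0)) w.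

Let E11_wt k : E 1 1 *m wt k = k%:R *: wt k.
Proof.
case: w_hw => w0 _ _ w1; elim: k => [|k IH]; first by rewrite w1 scale0r.
have := E_gl2 1 1 1 0; rewrite eqxx /= mulr1n mulr0n subr0 => /eqP.
rewrite subr_eq => /eqP H; rewrite /= mulmxA H mulmxDl -mulmxA IH -scalemxAr.
by rewrite -{1}[E 1 0 *m wt k]scale1r -scalerDl nat1r.
Qed.

Let E00_wt k : E 0 0 *m wt k = (m%:R - k%:R) *: wt k.
Proof.
case: w_hw => w0 _ w1 _; elim: k => [|k IH]; first by rewrite w1 subr0.
have := E_gl2 0 0 1 0; rewrite eqxx /= mulr1n mulr0n sub0r => /eqP.
rewrite subr_eq => /eqP H; rewrite /= mulmxA H mulmxDl -mulmxA IH -scalemxAr.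
by rewrite mulNmx -scaleN1r -scalerDl; congr (_ *: _); rewrite -natr1; ring.
Qed.

Let wtS k : wt k.+1 = E 1 0 *m wt k. Proof. by []. Qed.

Let E01_wt k : E 0 1 *m wt k.+1 = (k.+1%:R * (m%:R - k%:R)) *: wt k.
Proof.
have step v : E 0 1 *m (E 1 0 *m v) = E 1 0 *m (E 0 1 *m v) + (E 0 0 *m v - E 1 1 *m v).
  have := E_gl2 0 1 1 0; rewrite eqxx /= !mulr1n => /eqP; rewrite subr_eq => /eqP H.
  by rewrite mulmxA H mulmxDl mulmxBl -mulmxA addrC.
elim: k => [|k IH]; rewrite wtS step E00_wt E11_wt -scalerBl.
  by case: w_hw => _ -> _ _; rewrite mulmx0 add0r !subr0 mul1r.
by rewrite IH -scalemxAr -wtS -scalerDl; congr (_ *: _); rewrite -!natr1; ring.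
Qed.

(** Otherwise e_22 would have infinitely many eigenvalues on a finite-dimensional space. *)
Lemma wt_nilpotent : exists k, wt k = 0.
Proof.
apply: contrapT => wt0.
have roots k : (char_poly (E 1 1)^T).[k%:R] = 0.
  apply/rootP; rewrite -eigenvalue_root_char; apply/eigenvalueP; exists (wt k)^T.
    by rewrite -trmx_mul E11_wt linearZ.
  by apply/eqP => /(congr1 trmx); rewrite trmxK trmx0 => wk; apply: wt0; exists k.
have := poly_eq0_of_injective_roots (@mulrIn K 1 (oner_neq0 K)) roots.
by apply/eqP; rewrite monic_neq0 // char_poly_monic.
Qed.

Lemma wt_eq0 k : (wt k == 0) = (m < k)%N.
Proof.
have down j : wt j = 0 -> wt j.+1 = 0 by move=> /= ->; rewrite mulmx0.
have ex : exists j, wt j == 0 by have [j /eqP] := wt_nilpotent; exists j.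
case: (ex_minnP ex) => N /eqP N0 minN.
have Nm : N = m.+1.
  case: N N0 minN => [|N] N0 minN; first by case: w_hw; rewrite -[w]/(wt 0) N0 eqxx.
  have wN : wt N != 0 by apply/negP => /minN; rewrite ltnn.
  have /esym/eqP := E01_wt N; rewrite N0 mulmx0 scaler_eq0 (negbTE wN) orbF.
  by rewrite mulf_eq0 pnatr_eq0 subr_eq0 eqr_nat => /eqP ->.
apply/idP/idP => [/minN|mk]; first by rewrite Nm.
by rewrite -(subnK mk); elim: (k - _)%N => [|j /eqP/down/eqP //]; rewrite -Nm N0.
Qed.

Let wn k : 'cV[K]_d := (k`! * m ^_ k)%:R^-1 *: wt k.

Let coef_neq0 k : (k <= m)%N -> (k`! * m ^_ k)%:R != 0 :> K.
Proof. by move=> km; rewrite pnatr_eq0 -lt0n muln_gt0 fact_gt0 ffact_gt0. Qed.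

Let wn_coef k : (k < m)%N ->
  (k`! * m ^_ k)%:R^-1 = k.+1%:R * (m%:R - k%:R) * (k.+1`! * m ^_ k.+1)%:R^-1 :> K.
Proof.
move=> km; have := coef_neq0 km; rewrite factS ffactnSr !natrM natrB ?(ltnW km) //.
move: (k`!%:R : K) ((m ^_ k)%:R : K) (k.+1%:R : K) (m%:R - k%:R : K) => x y p q.
by rewrite !mulf_eq0 !negb_or => /andP[/andP[p0 x0] /andP[y0 q0]]; field; rewrite x0 y0 p0 q0.
Qed.

Let E01_wn k : (k < m)%N -> E 0 1 *m wn k.+1 = wn k.
Proof.
move=> km; rewrite /wn -scalemxAr E01_wt scalerA; congr (_ *: _).
by rewrite mulrC -wn_coef.
Qed.

Let E10_wn k : E 1 0 *m wn k = (k.+1%:R * (m%:R - k%:R)) *: wn k.+1.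
Proof.
rewrite /wn -scalemxAr -wtS scalerA; have [km|mk] := ltnP k m; first by rewrite wn_coef.
have -> : wt k.+1 = 0 by apply/eqP; rewrite wt_eq0.
by rewrite !scaler0.
Qed.

Lemma E01_iter j k : (k <= m)%N ->
  iter j (mulmx (E 0 1)) (wn k) = if (j <= k)%N then wn (k - j) else 0.
Proof.
elim: j => [|j IH] km; first by rewrite subn0.
rewrite iterS IH //; have [jk|kj] := ltnP j k.
  by rewrite ltnW // -[RHS]E01_wn ?subnSK //; lia.
have [kj'|kj'] := leqP j k; last by rewrite mulmx0.
have -> : (k - j = 0)%N by apply/eqP; rewrite subn_eq0.
by rewrite /wn /wt /= -scalemxAr; case: w_hw => _ -> _ _; rewrite scaler0.
Qed.

(** The columns of [P] are the rescaled weight vectors. The left inverse [Q] records injectivity in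
    a form that passes to tensor products. *)
Lemma hw_module_std : exists (P : 'M[K]_(d, m.+1)) (Q : 'M[K]_(m.+1, d)),
  Q *m P = 1%:M /\ forall i j, E i j *m P = P *m std_rep i j.
Proof.
pose P : 'M[K]_(d, m.+1) := \matrix_(i, k) wn k i 0.
have col_P (k : 'I_m.+1) : col k P = wn k.
  by apply/colP => i; rewrite !mxE.
have mulP (u : 'cV[K]_m.+1) : P *m u = \sum_k u k 0 *: wn k.
  apply/colP => i; rewrite !mxE summxE; apply: eq_bigr => k _; by rewrite !mxE mulrC.
have P_inj (u : 'cV[K]_m.+1) : P *m u = 0 -> u = 0.
  rewrite mulP => u0; apply: contrapT => /eqP un0.
  have /existsP[k1 uk1] : [exists k, u k 0 != 0].
    apply: contraNT un0 => /existsPn H; apply/eqP/colP => k; rewrite mxE.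
    by have := H k; rewrite negbK => /eqP.
  case: (@arg_maxnP _ k1 (fun k => u k 0 != 0) (fun k => k : nat) uk1) => k uk maxk.
  (* With k the largest index in the support of [u], applying e_12 k times leaves only a nonzero
     multiple of w. *)
  have : iter k (mulmx (E 0 1)) (\sum_j u j 0 *: wn j) = 0.
    by rewrite u0; elim: (k : nat) => //= j ->; rewrite mulmx0.
  have iterD j (F : 'I_m.+1 -> 'cV[K]_d) :
      iter j (mulmx (E 0 1)) (\sum_i u i 0 *: F i) = \sum_i u i 0 *: iter j (mulmx (E 0 1)) (F i).
    elim: j => //= j ->; rewrite mulmx_sumr; apply: eq_bigr => i _; by rewrite scalemxAr.
  rewrite iterD (bigD1 k) //= big1 => [|j jk].
    have km : (k <= m)%N by rewrite -ltnS ltn_ord.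
    rewrite addr0 (E01_iter k km) leqnn subnn => /eqP.
    rewrite scaler_eq0 (negbTE uk) /= /wn fact0 ffactn0 mul1n invr1 scale1r.
    by case: w_hw => /negbTE ->.
  have [uj|uj] := eqVneq (u j 0) 0; first by rewrite uj scale0r.
  have jm : (j <= m)%N by rewrite -ltnS ltn_ord.
  rewrite (E01_iter k jm); case: leqP => [kj|_]; last by rewrite scaler0.
  have jk' : (j <= k)%N := maxk _ uj.
  by case/eqP: jk; apply/val_inj/anti_leq; rewrite /= kj jk'.
have : row_free P^T.
  apply: inj_row_free => v vP; apply: trmx_inj; rewrite trmx0; apply: P_inj.
  by apply: trmx_inj; rewrite trmx_mul trmxK vP trmx0.
case/row_freeP => Q PQ; exists P, Q^T; split.
  by apply: trmx_inj; rewrite trmx_mul trmxK PQ trmx1.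
have E00_wn k : E 0 0 *m wn k = (m%:R - k%:R) *: wn k.
  by rewrite /wn -scalemxAr E00_wt !scalerA mulrC.
have E11_wn k : E 1 1 *m wn k = k%:R *: wn k.
  by rewrite /wn -scalemxAr E11_wt !scalerA mulrC.
have E01_wn0 : E 0 1 *m wn 0 = 0.
  by rewrite /wn /= -scalemxAr; case: w_hw => _ -> _ _; rewrite scaler0.
move=> i j; apply/matrixP => a b.
have -> : (E i j *m P) a b = (E i j *m wn b) a 0.
  by rewrite [LHS]mxE [RHS]mxE; apply: eq_bigr => k _; rewrite -col_P !mxE.
have -> : (P *m std_rep i j) a b = (\sum_k std_rep i j k b *: wn k) a 0.
  rewrite mxE summxE; apply: eq_bigr => k _; rewrite !mxE mulrC //.
congr (fun_of_matrix _ a 0); clear a.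
have single (k : 'I_m.+1) (F : 'I_m.+1 -> 'cV[K]_d) :
    (forall k', k' != k -> F k' = 0) -> \sum_k' F k' = F k.
  by move=> F0; rewrite (bigD1 k) //= big1 ?addr0.
have /orP[/eqP ->|/eqP ->] : (i == 0) || (i == 1) by case: i => [[|[|]]].
- have /orP[/eqP ->|/eqP ->] : (j == 0) || (j == 1) by case: j => [[|[|]]].
  + rewrite E00_wn (single b) => [|k kb]; first by rewrite !mxE !eqxx mul1r.
    by rewrite !mxE /= (negbTE kb) mul0r scale0r.
  case: b => -[|b] bm; rewrite -/(wn _) /=.
    by rewrite E01_wn0 big1 // => k _; rewrite !mxE scale0r.
  rewrite E01_wn // (single (Ordinal (ltnW bm))) => [|k kb].
    by rewrite !mxE /= eqxx scale1r.
  by rewrite !mxE /= eqSS (negbTE (_ : k != b :> nat)) ?scale0r.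
have /orP[/eqP ->|/eqP ->] : (j == 0) || (j == 1) by case: j => [[|[|]]].
- rewrite E10_wn; have [bm|mb] := ltnP b m.
    have bm' : (b.+1 < m.+1)%N by [].
    rewrite (single (Ordinal bm')) => [|k kb].
      by rewrite !mxE /= eqxx mul1r -natr1; congr (_ *: _); ring.
    by rewrite !mxE /= (negbTE (_ : k != b.+1 :> nat)) ?mul0r ?scale0r.
  have bE : (b : nat) = m by apply/eqP; rewrite eqn_leq mb -ltnS ltn_ord.
  rewrite bE subrr mulr0 scale0r big1 // => k _; rewrite !mxE /= bE.
  by rewrite ltn_eqF ?ltn_ord // mul0r scale0r.
rewrite E11_wn (single b) => [|k kb]; first by rewrite !mxE /= !eqxx mul1r.
by rewrite !mxE /= (negbTE kb) mul0r scale0r.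
Qed.

End StandardModule.

(** * Tensor products in coordinates *)

Section TensorMaps.
Variables (K : fieldType) (n : nat).
Implicit Types d : 'I_n -> nat.

Definition multi_index d := {dffun forall s : 'I_n, 'I_(d s)}.

Definition update d (k : multi_index d) (s : 'I_n) (j : 'I_(d s)) : multi_index d :=
  finfun (dfwith k s j).
Arguments update {d} k s j.

Lemma update_same d (k : multi_index d) s j : update k s j s = j.
Proof. by rewrite ffunE dfwithin. Qed.

Lemma update_other d (k : multi_index d) s j r : r != s -> update k s j r = k r.
Proof. by move=> rs; rewrite ffunE dfwithout // eq_sym. Qed.

Lemma update_update d (k : multi_index d) s j : update (update k s j) s (k s) = k.
Proof.
apply/ffunP => r; have [->|rs] := eqVneq r s; first by rewrite update_same.
by rewrite !update_other.
Qed.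

Lemma act_atE d s (A : 'M[K]_(d s)) (f : tensor_space K d) (k : multi_index d) :
  act_at A f k = \sum_(j < d s) A (k s) j * f (update k s j).
Proof. by rewrite ffunE. Qed.

Lemma act_atZ d s (A : 'M[K]_(d s)) c f : act_at A (c *: f) = c *: act_at A f.
Proof.
apply/ffunP => k; rewrite [RHS]ffunE !act_atE scaler_sumr; apply: eq_bigr => j _.
by rewrite ffunE; exact: mulrCA.
Qed.

(** The range of j depends on s; tagging the indices gives all the factors a common index type. *)
Lemma dffun_distr d (F : forall s : 'I_n, 'I_(d s) -> K) :
  \prod_(s < n) \sum_(j < d s) F s j = \sum_(k : multi_index d) \prod_(s < n) F s (k s).
Proof.
rewrite [RHS](reindex (@dffun_of_fprod _ _)); last exact/onW_bij/dffun_of_fprod_bij.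
pose G s : {ffun 'I_(d s) -> K} := [ffun j => F s j].
transitivity (\sum_(t : fprod (fun s => 'I_(d s))) \prod_(s in 'I_n) G s (t s)).
  rewrite big_fprod.
  transitivity (\prod_(s < n) \sum_(j in tagged_with (fun s => 'I_(d s)) s)
    untag 0 (G s) j); last exact: bigA_distr_big_dep.
  apply: eq_bigr => s _.
  transitivity (\sum_(j < d s) G s j); last exact: (@big_tag _ _ _ _ (fun s => 'I_(d s)) G s).
  by apply: eq_bigr => j _; rewrite ffunE.
by apply: eq_bigr => t _; apply: eq_bigr => s _; rewrite !ffunE.
Qed.

Definition tensor_map d d' (P : forall s, 'M[K]_(d s, d' s)) (f : tensor_space K d') :
    tensor_space K d :=
  [ffun k : multi_index d => \sum_(j : multi_index d') (\prod_(s < n) P s (k s) (j s)) * f j].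

Lemma tensor_mapD d d' (P : forall s, 'M[K]_(d s, d' s)) f g :
  tensor_map P (f + g) = tensor_map P f + tensor_map P g.
Proof.
apply/ffunP => k; rewrite !ffunE -big_split; apply: eq_bigr => j _; by rewrite ffunE mulrDr.
Qed.

Lemma tensor_mapZ d d' (P : forall s, 'M[K]_(d s, d' s)) c f :
  tensor_map P (c *: f) = c *: tensor_map P f.
Proof.
apply/ffunP => k; rewrite !ffunE scaler_sumr; apply: eq_bigr => j _; rewrite ffunE.
exact: mulrCA.
Qed.

Lemma tensor_map0 d d' (P : forall s, 'M[K]_(d s, d' s)) : tensor_map P 0 = 0.
Proof. by rewrite -[0 in LHS](scale0r 0) tensor_mapZ scale0r. Qed.

Lemma tensor_map_sum d d' (P : forall s, 'M[K]_(d s, d' s)) I (r : seq I) (Q : pred I) F :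
  tensor_map P (\sum_(i <- r | Q i) F i) = \sum_(i <- r | Q i) tensor_map P (F i).
Proof.
exact: (big_morph _ (tensor_mapD P) (tensor_map0 P)).
Qed.

Lemma tensor_map_comp d d' d'' (P : forall s, 'M[K]_(d s, d' s))
    (Q : forall s, 'M[K]_(d' s, d'' s)) f :
  tensor_map P (tensor_map Q f) = tensor_map (fun s => P s *m Q s) f.
Proof.
apply/ffunP => k; rewrite !ffunE.
under eq_bigr do rewrite ffunE mulr_sumr.
rewrite exchange_big; apply: eq_bigr => i _ /=.
rewrite (eq_bigr (fun s => \sum_j P s (k s) j * Q s j (i s))) => [|s _]; last by rewrite mxE.
rewrite (dffun_distr (fun s j => P s (k s) j * Q s j (i s))) mulr_suml.
by apply: eq_bigr => j _; rewrite mulrA -big_split.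
Qed.

Lemma tensor_map1 d (f : tensor_space K d) : tensor_map (fun s => 1%:M) f = f.
Proof.
apply/ffunP => k; rewrite ffunE (bigD1 k) //= [X in _ + X]big1 => [|j jk].
  by rewrite addr0 big1 ?mul1r // => s _; rewrite mxE eqxx.
have [s js] : exists s, j s != k s.
  apply/existsP; apply: contraNT jk => /existsPn H; apply/eqP/ffunP => s.
  by have := H s; rewrite negbK => /eqP.
by rewrite (bigD1 s) //= mxE eq_sym (negbTE js) !mul0r.
Qed.

Lemma act_at_tensor_map d d' (P : forall s, 'M[K]_(d s, d' s)) s
    (A : 'M[K]_(d s)) (A' : 'M[K]_(d' s)) f : A *m P s = P s *m A' ->
  act_at A (tensor_map P f) = tensor_map P (act_at A' f).
Proof.
move=> AP; apply/ffunP => k; rewrite act_atE [RHS]ffunE.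
pose R j := \prod_(r < n | r != s) P r (k r) (j r).
transitivity (\sum_(j : multi_index d') R j * ((A *m P s) (k s) (j s) * f j)).
  under eq_bigr do rewrite ffunE mulr_sumr.
  rewrite exchange_big; apply: eq_bigr => j _ /=.
  rewrite mxE !mulr_suml mulr_sumr; apply: eq_bigr => a _.
  rewrite (bigD1 s) //= update_same.
  have -> : \prod_(r < n | r != s) P r (update k s a r) (j r) = R j.
    by apply: eq_bigr => r rs; rewrite update_other.
  ring.
rewrite AP.
transitivity (\sum_(j : multi_index d') \sum_(b < d' s)
    R j * (P s (k s) b * A' b (j s) * f j)).
  by apply: eq_bigr => j _; rewrite mxE mulr_suml mulr_sumr.
transitivity (\sum_(j : multi_index d') \sum_(b < d' s)
    R j * (P s (k s) (j s) * A' (j s) b * f (update j s b))); last first.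
  apply: eq_bigr => j _; rewrite act_atE mulr_sumr; apply: eq_bigr => b _.
  by rewrite (bigD1 s) //= -/(R j); ring.
rewrite !pair_big /=.
(* Exchanging the index summed in the matrix product with the s-th component of j is an involution
   that carries one double sum to the other. *)
pose swap (p : multi_index d' * 'I_(d' s)) := (update p.1 s p.2, p.1 s).
have swapK : involutive swap.
  by move=> [j b]; rewrite /swap /= update_update update_same.
rewrite (reindex_inj (inv_inj swapK)); apply: eq_bigr => -[j b] _ /=.
rewrite update_same; congr (_ * _); apply: eq_bigr => r rs; by rewrite update_other.
Qed.

End TensorMaps.
Arguments update {n d} k s j.

Section Intertwiners.
Variables (K : fieldType) (n : nat) (d d' : 'I_n -> nat).
Variables (E : forall s, 'I_2 -> 'I_2 -> 'M[K]_(d s)).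
Variables (E' : forall s, 'I_2 -> 'I_2 -> 'M[K]_(d' s)).
Variables (P : forall s, 'M[K]_(d s, d' s)) (z : 'I_n -> K) (m : 'I_n -> nat).
Hypothesis EP : forall s i j, E s i j *m P s = P s *m E' s i j.

Lemma tensor_act_map i j f :
  tensor_act E i j (tensor_map P f) = tensor_map P (tensor_act E' i j f).
Proof.
rewrite /tensor_act tensor_map_sum; apply: eq_bigr => s _.
by rewrite (act_at_tensor_map _ (EP s i j)).
Qed.

Lemma gaudin_hamiltonian_map s f :
  gaudin_hamiltonian E z m s (tensor_map P f) =
  tensor_map P (gaudin_hamiltonian E' z m s f).
Proof.
rewrite /gaudin_hamiltonian tensor_map_sum; apply: eq_bigr => r _.
rewrite [RHS]tensor_mapZ tensor_mapD -[in RHS]scaleN1r !tensor_mapZ scaleN1r.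
congr (_ *: (_ - _)); rewrite /Omega tensor_map_sum; apply: eq_bigr => i _.
rewrite tensor_map_sum; apply: eq_bigr => j _.
by rewrite (act_at_tensor_map _ (EP r j i)) (act_at_tensor_map _ (EP s i j)).
Qed.

Lemma gaudin_hamiltonianZ s c f :
  gaudin_hamiltonian E z m s (c *: f) = c *: gaudin_hamiltonian E z m s f.
Proof.
rewrite /gaudin_hamiltonian scaler_sumr; apply: eq_bigr => r _.
have scaleC (a b : K) (g : tensor_space K d) : a *: (b *: g) = b *: (a *: g).
  by rewrite !scalerA mulrC.
rewrite [RHS]scaleC [X in _ = _ *: X]scalerBr [X in _ = _ *: (X - _)]scaleC.
congr (_ *: (_ - _)).
rewrite /Omega scaler_sumr; apply: eq_bigr => i _.
by rewrite scaler_sumr; apply: eq_bigr => j _; rewrite !act_atZ.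
Qed.

End Intertwiners.

Lemma bethe_algebraZ (K : fieldType) (n : nat) (d : 'I_n -> nat)
    (E : forall s, 'I_2 -> 'I_2 -> 'M[K]_(d s)) z m f :
  bethe_algebra E z m f -> forall c v, f (c *: v) = c *: f v.
Proof.
elim=> {f} [|s|f g _ fZ _ gZ|a f _ fZ|f g _ fZ _ gZ] c v //=.
- exact: gaudin_hamiltonianZ.
- by rewrite fZ gZ scalerDr.
- by rewrite fZ !scalerA mulrC.
- by rewrite gZ fZ.
Qed.

Lemma eigenvector_is_bethe (K : fieldType) (n : nat) (d : 'I_n -> nat)
    (E : forall s, 'I_2 -> 'I_2 -> 'M[K]_(d s)) z m l (h : 'I_n -> K) (v : tensor_space K d) :
  Sing E l v -> v != 0 -> (forall s, gaudin_hamiltonian E z m s v = h s *: v) ->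
  is_bethe_eigenvector E z m l v.
Proof.
move=> sv v0 hv; split => // f.
elim=> {f} [|s|f g _ [a fa] _ [b gb]|c f _ [a fa]|f g fA [a fa] _ [b gb]].
- by exists 1; rewrite scale1r.
- by exists (h s).
- by exists (a + b); rewrite fa gb scalerDl.
- by exists (c * a); rewrite fa scalerA.
by exists (b * a); rewrite /= gb (bethe_algebraZ fA) fa scalerA.
Qed.

Section TensorFunctions.
Variables (K : numFieldType) (n : nat) (m : 'I_n -> nat).
Local Notation index := (multi_index (fun s => (m s).+1)).
Local Notation std := (fun s : 'I_n => @std_rep K (m s)).
Implicit Types (F : ('I_n -> nat) -> K) (kap : 'I_n -> nat) (s r : 'I_n).

Definition exponents (k : index) : 'I_n -> nat := fun s => k s.

(** [F] is defined on unrestricted exponents so that shifts need no proofs of bounds; only its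
    values with kap_s <= m_s are read. *)
Definition tensor_of F : tensor_space K (fun s => (m s).+1) :=
  [ffun k : index => F (exponents k)].

Definition lower s kap : 'I_n -> nat := fun r => (kap r - (r == s))%N.

Lemma exponents_update (k : index) s j :
  exponents (update k s j) = fun r => if r == s then nat_of_ord j else nat_of_ord (k r).
Proof.
apply: funext => r; rewrite /exponents; have [->|rs] := eqVneq; first by rewrite update_same.
by rewrite update_other.
Qed.

(** At the last index the matrix gives 0 while the right-hand side reads [F] at m_s + 1. This is
    where truncation lets a vector descend to the irreducible modules. *)
Lemma act_at_std01 F s : (forall kap, (m s < kap s)%N -> F kap = 0) ->
  act_at (std s 0 1) (tensor_of F) = tensor_of (F \o raise s).
Proof.
move=> F0; apply/ffunP => k; rewrite act_atE [RHS]ffunE /=.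
have [km|km] := ltnP (k s) (m s).
  rewrite (bigD1 (Ordinal (km : ((k s).+1 < (m s).+1)%N))) //= big1 => [|j jk].
    rewrite !mxE /= eqxx mul1r addr0 ffunE exponents_update; congr F; apply: funext => r.
    by rewrite /raise /exponents /=; case: eqP => [->|_]; rewrite ?addn1 ?addn0.
  by rewrite !mxE /= [_ == _ :> nat]eq_sym (negbTE (_ : j != (k s).+1 :> nat)) ?mul0r.
rewrite big1 => [|j _]; first by rewrite F0 // /raise eqxx addn1.
by rewrite !mxE /= gtn_eqF ?mul0r // (leq_trans (ltn_ord j)).
Qed.

Lemma act_at_std10 F s : act_at (std s 1 0) (tensor_of F) =
  tensor_of (fun kap => (kap s)%:R * ((m s)%:R + 1 - (kap s)%:R) * F (lower s kap)).
Proof.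
apply/ffunP => k; rewrite act_atE [RHS]ffunE /=.
case: (posnP (exponents k s)) => [k0|kp].
  rewrite k0 mul0r mul0r big1 // => j _; rewrite !mxE /=.
  by rewrite (k0 : k s = 0%N :> nat) !mul0r.
have km : ((k s).-1 < (m s).+1)%N by rewrite (leq_ltn_trans (leq_pred _)).
rewrite (bigD1 (Ordinal km)) //= big1 => [|j jk].
  rewrite !mxE /= prednK // eqxx mul1r addr0 ffunE exponents_update; congr (_ * F _).
  apply: funext => r.
  by rewrite /lower /exponents /=; case: eqP => [->|_]; rewrite ?subn1 ?subn0.
rewrite !mxE /= (negbTE (_ : k s != j.+1 :> nat)) ?mul0r //.
by apply: contra_neq jk => kj; apply/val_inj; rewrite /= kj.
Qed.

Lemma act_at_std00 F s : act_at (std s 0 0) (tensor_of F) =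
  tensor_of (fun kap => ((m s)%:R - (kap s)%:R) * F kap).
Proof.
apply/ffunP => k; rewrite act_atE [RHS]ffunE (bigD1 (k s)) //= big1 => [|j jk].
  rewrite !mxE /= eqxx mul1r addr0 ffunE exponents_update; congr (_ * F _).
  by apply: funext => r; case: eqP => [->|].
by rewrite !mxE /= eq_sym (negbTE jk) !mul0r.
Qed.

Lemma act_at_std11 F s : act_at (std s 1 1) (tensor_of F) =
  tensor_of (fun kap => (kap s)%:R * F kap).
Proof.
apply/ffunP => k; rewrite act_atE [RHS]ffunE (bigD1 (k s)) //= big1 => [|j jk].
  rewrite !mxE /= eqxx mul1r addr0 ffunE exponents_update; congr (_ * F _).
  by apply: funext => r; case: eqP => [->|].
by rewrite !mxE /= eq_sym (negbTE jk) !mul0r.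
Qed.

Lemma Omega_std F s r : r != s -> (forall t kap, (m t < kap t)%N -> F kap = 0) ->
  Omega std s r (tensor_of F) = tensor_of (fun kap =>
    (((m s)%:R - (kap s)%:R) * ((m r)%:R - (kap r)%:R) + (kap s)%:R * (kap r)%:R) * F kap
    + (kap s)%:R * ((m s)%:R + 1 - (kap s)%:R) * F (transfer s r kap)
    + (kap r)%:R * ((m r)%:R + 1 - (kap r)%:R) * F (transfer r s kap)).
Proof.
move=> rs F0; have sr : (s == r) = false by rewrite eq_sym (negbTE rs).
rewrite /Omega !big_ord_recl !big_ord0 !addr0 /=.
have -> : lift ord0 ord0 = 1 :> 'I_2 by apply/val_inj.
rewrite (act_at_std00 F r) act_at_std00 (act_at_std10 F r) act_at_std01; last first.
  by move=> kap ms; rewrite (F0 s) ?mulr0 // /lower sr subn0.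
rewrite (act_at_std01 (F0 r)) act_at_std10 (act_at_std11 F r) act_at_std11.
apply/ffunP => k; rewrite !ffunE /=; set kap := exponents k.
have -> : raise s kap r = kap r by rewrite /raise (negbTE rs) addn0.
have -> : lower r (raise s kap) = transfer r s kap.
  apply: funext => t; rewrite /lower /raise /transfer.
  by have [->|_] := eqVneq t s; rewrite ?sr ?subn0 ?addn0.
have -> : raise r (lower s kap) = transfer s r kap by [].
ring.
Qed.

End TensorFunctions.

Section SingularVector.
Variables (K : numFieldType) (n : nat) (z : 'I_n -> K) (m : 'I_n -> nat) (h : 'I_n -> K).
Variables (l : nat) (phi : ('I_n -> nat) -> K).
Local Notation std := (fun s : 'I_n => @std_rep K (m s)).
Hypothesis phi_raise : forall kap, (\sum_(s < n) kap s).+1 = l ->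
  \sum_(s < n) phi (raise s kap) = 0.
Hypothesis phi_trunc : forall kap s, (\sum_(r < n) kap r)%N = l -> (m s < kap s)%N ->
  phi kap = 0.
Hypothesis phi_gaudin : forall kap s, \sum_(r < n | r != s) (z s - z r)^-1 *
    (((m s * kap r)%:R + (m r * kap s)%:R - 2 * (kap s * kap r)%:R) * phi kap
     - (kap s)%:R * ((m s)%:R + 1 - (kap s)%:R) * phi (transfer s r kap)
     - (kap r)%:R * ((m r)%:R + 1 - (kap r)%:R) * phi (transfer r s kap))
  = h s * phi kap.
Hypothesis phi_neq0 : exists kap, (\sum_(s < n) kap s)%N = l /\ phi kap != 0.

(** [phi] has values in every total degree; the eigenvalue l of e_22 selects one of them. *)
Let F kap := if (\sum_(s < n) kap s)%N == l then phi kap else 0.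

Definition singular_vector : tensor_space K (fun s => (m s).+1) := tensor_of m F.

Let F_trunc s kap : (m s < kap s)%N -> F kap = 0.
Proof. by move=> ms; rewrite /F; case: eqP => // kl; apply: phi_trunc ms. Qed.

Lemma singular_vector_neq0 : singular_vector != 0.
Proof.
have [kap [kl kn]] := phi_neq0.
have km s : (kap s < (m s).+1)%N.
  by rewrite ltnS leqNgt; apply: contra kn => ms; rewrite (phi_trunc kl ms).
apply: contraNneq kn => /ffunP/(_ [ffun s => Ordinal (km s)]); rewrite !ffunE.
suff -> : exponents [ffun s => Ordinal (km s)] = kap by rewrite /F kl eqxx => ->.
by apply: funext => s; rewrite /exponents ffunE.
Qed.

Lemma singular_vector_Sing : Sing std l singular_vector.
Proof.
split; apply/ffunP => k; rewrite /tensor_act sum_ffunE !ffunE.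
  transitivity (\sum_(s < n) F (raise s (exponents k))).
    by apply: eq_bigr => s _; rewrite (act_at_std01 (@F_trunc s)) ffunE.
  under eq_bigr do rewrite /F sum_raise.
  case: eqP => [kl|_]; last exact: big1.
  exact: phi_raise.
under eq_bigr do rewrite /singular_vector act_at_std11 ffunE.
rewrite -mulr_suml; rewrite /F; case: eqP => [<-|_]; last by rewrite mulr0 scaler0.
by rewrite natr_sum.
Qed.

Lemma singular_vector_gaudin s :
  gaudin_hamiltonian std z m s singular_vector = h s *: singular_vector.
Proof.
apply/ffunP => k; rewrite /gaudin_hamiltonian sum_ffunE [RHS]ffunE.
set kap := exponents k.
have F_transfer t r : (kap t)%:R * ((m t)%:R + 1 - (kap t)%:R) * F (transfer t r kap) =
    (if (\sum_(s < n) kap s)%N == l then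
      (kap t)%:R * ((m t)%:R + 1 - (kap t)%:R) * phi (transfer t r kap) else 0) :> K.
  case: (posnP (kap t)) => [->|kt]; first by rewrite !mul0r; case: ifP.
  by rewrite /F sum_transfer //; case: ifP; rewrite // mulr0.
transitivity (\sum_(r < n | r != s) (z s - z r)^-1 *
    (((m s * kap r)%:R + (m r * kap s)%:R - 2 * (kap s * kap r)%:R) * F kap
     - (kap s)%:R * ((m s)%:R + 1 - (kap s)%:R) * F (transfer s r kap)
     - (kap r)%:R * ((m r)%:R + 1 - (kap r)%:R) * F (transfer r s kap))).
  apply: eq_bigr => r rs; rewrite /singular_vector Omega_std // !ffunE -/kap.
  by rewrite /GRing.scale /= !natrM; ring.
under eq_bigr do rewrite !F_transfer.
rewrite ffunE -/kap /F; case: ifP => _; first exact: phi_gaudin.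
by rewrite [RHS]mulr0 big1 // => r _; rewrite mulr0 !subr0 mulr0.
Qed.

End SingularVector.

(** * The eigenvector *)

Section BetheVector.
Variables (K : numFieldType) (n : nat) (z : 'I_n -> K) (m : 'I_n -> nat) (h : 'I_n -> K).
Variable l : nat.
Local Notation M := (\sum_(s < n) m s)%N.
Local Notation D := (oper z m h).
Local Notation std := (fun s : 'I_n => @std_rep K (m s)).
Hypothesis z_inj : injective z.
Hypothesis dominant : (2 * l <= M)%N.
Hypothesis h_sum : \sum_(s < n) h s = 0.
Hypothesis zh_sum : \sum_(s < n) z s * h s = l%:R * (M%:R + 1 - l%:R).
Hypothesis n_gt0 : (0 < n)%N.

Lemma sing_dvd_solution u : D u = 0 -> (forall s, u.[z s] = 0) -> sing z m %| u.
Proof. by move=> Du u0; apply: sing_dvdP => // s; exact: (solution_dvd z_inj Du). Qed.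

Lemma exists_eigenvector_std (x0 : K) (p1 p2 : {poly K}) :
  D p1 = 0 -> D p2 = 0 -> p1.[x0] = 1 -> p1^`().[x0] = 0 -> p2.[x0] = 0 -> p2^`().[x0] = 1 ->
  exists v : tensor_space K (fun s => (m s).+1),
    [/\ Sing std l v, v != 0 & forall s, gaudin_hamiltonian std z m s v = h s *: v].
Proof.
move=> Dp1 Dp2 p1x dp1x p2x dp2x.
have [f [g [Df Dg sf sg]]] :=
  exists_solutions dominant h_sum zh_sum n_gt0 Dp1 Dp2 p1x dp1x p2x dp2x.
have exb := exists_nonvanishing_solution z_inj Dp1 Dp2 p1x dp1x p2x dp2x.
pose b i := sval (cid (exb i)).
have Db i : D (b i) = 0 by rewrite /b; case: cid => q [].
have bz i : (b i).[z i] = 1 by rewrite /b; case: cid => q [].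
have f0 : f != 0 by rewrite -size_poly_eq0 sf.
have [r0 fr0] : exists r, f.[z r] != 0.
  apply/existsP; apply: contraT => /existsPn fz.
  have /(dvdp_leq f0) : sing z m %| f.
    by apply: sing_dvd_solution => // s; have := fz s; rewrite negbK => /eqP.
  by rewrite size_sing sf; lia.
pose rho := local_residue m z_inj b; pose c i := f.[z i].
have rhoD i p q : rho i (p + q) = rho i p + rho i q by exact: local_residueD.
have rhoZ i a p : rho i (a *: p) = a * rho i p by exact: local_residueZ.
have rho_oper i q : rho i (D q) = 0 by apply: local_residue_oper.
have rho_dvd i p : ('X - (z i)%:P) ^+ (m i).+1 %| p -> rho i p = 0.
  exact: local_residue_dvd.
have rho_rel (p : {poly K}) : (size p < l + n)%N -> \sum_i c i * rho i p = 0.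
  by move=> pl; apply: (local_residue_relation z_inj Db bz Df); rewrite sf; lia.
have rho_indep : forall a : 'I_n -> K,
    (forall p : {poly K}, (size p < l + n)%N -> \sum_i a i * rho i p = 0) ->
    exists e, forall i, a i = e * c i.
  move=> a; exact: (local_residue_independent dominant h_sum zh_sum n_gt0 Db bz Df sf).
pose phi := multi_residue z r0 rho.
(* If f vanishes at all the other points, S divides f (x - z_r0)^(m_r0 + 1). Then M + n <= l + m_r0
   + 1, and 2 l <= M gives the bound. *)
have trunc : (forall i, i != r0 -> c i = 0) -> (l <= m r0)%N.
  move=> ci; have fy : f * ('X - (z r0)%:P) ^+ (m r0).+1 != 0.
    by rewrite mulf_neq0 // expf_neq0 // polyXsubC_eq0.
  have /(dvdp_leq fy) : sing z m %| f * ('X - (z r0)%:P) ^+ (m r0).+1.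
    apply: sing_dvdP => // i; have [->|ir] := eqVneq i r0; first exact: dvdp_mull.
    by apply/dvdp_mulr/(solution_dvd z_inj Df); exact: ci.
  by rewrite size_sing size_mul ?expf_neq0 ?polyXsubC_eq0 // sf size_exp_XsubC; lia.
have phi_trunc kap s : (\sum_(r < n) kap r)%N = l -> (m s < kap s)%N -> phi kap = 0.
  by move=> kl ms; apply: (multi_residue_truncation rhoD rhoZ rho_dvd rho_rel trunc kl ms).
have phi_raise kap : (\sum_(s < n) kap s).+1 = l -> \sum_(s < n) phi (raise s kap) = 0.
  move=> kl; rewrite (multi_residue_raise r0 z_inj rhoD rhoZ).
  apply: (multi_residue_low (c := c) (g := fun i => g.[z i]) z rhoD rhoZ rho_rel fr0 _ _ kl).
    by move=> p pl; apply: (local_residue_relation z_inj Db bz Dg); rewrite sg; lia.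
  move=> [e He]; have su : size (g - e *: f) = (M - l).+2.
    rewrite size_polyDl sg // size_polyN (leq_ltn_trans (size_scale_leq _ _)) // sf; lia.
  have u0 : g - e *: f != 0 by rewrite -size_poly_eq0 su.
  (* The degree M - l + 1 is below M + n because [kl] makes l positive; for n = 1 and l = 0 the two
     would be equal. *)
  have /(dvdp_leq u0) : sing z m %| g - e *: f.
    apply: sing_dvd_solution => [|s]; last by rewrite hornerD hornerN hornerZ He subrr.
    by rewrite -scaleNr operD operZ Dg Df scaler0 addr0.
  by rewrite size_sing su; lia.
have phi_gaudin := multi_residue_gaudin r0 z_inj h_sum rhoD rhoZ rho_oper.
have phi_neq0 := exists_multi_residue_neq0 (c := c) z_inj rhoD rhoZ rho_indep fr0.
exists (singular_vector m l phi); split.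
- exact: singular_vector_Sing.
- exact: singular_vector_neq0.
- exact: singular_vector_gaudin.
Qed.

End BetheVector.

(** Without points there is no r0 to omit; the empty tensor product is a line with zero action. *)
Lemma exists_eigenvector_dim0 (K : fieldType) (z : 'I_0 -> K) (m d : 'I_0 -> nat)
    (E : forall s, 'I_2 -> 'I_2 -> 'M[K]_(d s)) (h : 'I_0 -> K) :
  exists v : tensor_space K d,
    [/\ Sing E 0 v, v != 0 & forall s, gaudin_hamiltonian E z m s v = h s *: v].
Proof.
exists [ffun=> 1]; split; last by case.
- by split; rewrite /tensor_act big_ord0 ?scale0r.
pose k : multi_index d := [ffun s : 'I_0 =>
  match s with Ordinal _ lt => match notF lt with end end].
by apply/eqP => /ffunP/(_ k)/eqP; rewrite !ffunE oner_eq0.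
Qed.

Theorem corollary7p2p3 (R : realType) (n : nat) (z : 'I_n -> Cx R)
  (m : 'I_n -> nat) (l : nat)
  (z_distinct : injective z)
  (dominant : (2 * l <= \sum_(s < n) m s)%N)
  (d : 'I_n -> nat)
  (L : forall s : 'I_n, 'I_2 -> 'I_2 -> 'M[Cx R]_(d s))
  (L_hw : forall s : 'I_n, is_irreducible_hw_module (L s) (m s)%:R 0)
  (h : 'I_n -> Cx R)
  (h_sum : \sum_(s < n) h s = 0)
  (zh_sum : \sum_(s < n) z s * h s =
            l%:R * ((\sum_(s < n) m s)%:R + 1 - l%:R))
  (h_poly : all_solutions_polynomial z m h) :
  exists v : tensor_space (Cx R) d,
    is_bethe_eigenvector L z m l v /\
    forall s : 'I_n, gaudin_hamiltonian L z m s v = h s *: v.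
Proof.
suff [v [sv v0 hv]] : exists v : tensor_space (Cx R) d,
    [/\ Sing L l v, v != 0 & forall s, gaudin_hamiltonian L z m s v = h s *: v].
  by exists v; split => //; exact: eigenvector_is_bethe sv v0 hv.
case: (posnP n) => [n0|n_gt0].
  move: n0 dominant => n0; subst n; rewrite big_ord0 leqn0 muln_eq0 => /eqP ->.
  exact: exists_eigenvector_dim0.
have [x0 zx0] : exists x0, forall s, z s != x0.
  exists (1 + \sum_(s < n) `|z s|) => s; apply: contraTneq (leqnn 0) => zs.
  have : `|z s| <= \sum_(r < n) `|z r| by rewrite (bigD1 s) //= lerDl sumr_ge0.
  have S0 : 0 <= \sum_(r < n) `|z r| by apply: sumr_ge0.
  by rewrite {1}zs ger0_norm ?addr_ge0 // gerDr ler10.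
have [p1 [p1x dp1x Dp1]] := polynomial_solution 1 0 h_poly zx0.
have [p2 [p2x dp2x Dp2]] := polynomial_solution 0 1 h_poly zx0.
have [v' [[sv1 sv2] v0 hv]] := exists_eigenvector_std z_distinct dominant h_sum zh_sum n_gt0
  Dp1 Dp2 p1x dp1x p2x dp2x.
have PQ s : exists PQ : 'M[Cx R]_(d s, (m s).+1) * 'M[Cx R]_((m s).+1, d s),
    PQ.2 *m PQ.1 = 1%:M /\ forall i j, L s i j *m PQ.1 = PQ.1 *m std_rep _ (m s) i j.
  have [Lgl2 _ [w Lw]] := L_hw s.
  by have [P [Q H]] := hw_module_std Lgl2 Lw; exists (P, Q).
pose P s := (sval (cid (PQ s))).1; pose Q s := (sval (cid (PQ s))).2.
have QP s : Q s *m P s = 1%:M by rewrite /Q /P; case: cid => ? [].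
have LP s i j : L s i j *m P s = P s *m std_rep _ (m s) i j.
  by rewrite /P; case: cid => ? [].
exists (tensor_map P v'); split.
- by split; rewrite (tensor_act_map LP) ?sv1 ?sv2 ?tensor_mapZ ?tensor_map0.
(* The left inverses [Q s] recover [v'] from its image, which is therefore nonzero. *)
- apply: contraNneq v0 => Pv; rewrite -(tensor_map1 v').
  have -> : (fun s => 1%:M) = (fun s => Q s *m P s).
    by apply: functional_extensionality_dep => s; rewrite QP.
  by rewrite -tensor_map_comp Pv tensor_map0.
- by move=> s; rewrite (gaudin_hamiltonian_map _ _ LP) hv tensor_mapZ.
Qed.
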